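(* Let $H$ be a complex Hilbert space and let $T\in B(H)$ be power bounded. Then for all real polynomials $p,q\in\mathbb{R}[\cdot]$ the weighted averages $$ \frac1N\sum_{n=1}^N e^{2\pi i q(n)}T^{[p(n)]} $$ converge in the strong operator topology as $N\to\infty$.
   Context: $T$ is power bounded if $\sup_{n\ge0}\|T^n\|<\infty$, and $[\cdot]$ is the integer part. Convention: $T^{[p(n)]}=I$ (the identity operator) if the exponent $[p(n)]$ is negative. *)

(* Defs.v *)
From HB Require Import structures.
From mathcomp Require Export all_boot all_order all_algebra.
From mathcomp Require Export sesquilinear complex.
From mathcomp Require Export all_classical all_reals all_analysis.

Set Implicit Arguments.
Unset Strict Implicit.
Unset Printing Implicit Defensive.

Import Order.TTheory GRing.Theory Num.Theory.
Import numFieldNormedType.Exports.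

Local Open Scope classical_set_scope.
Local Open Scope ring_scope.

(* A complex Hilbert space is a complete normed module over R[i] together with
   a dot product (linear in its first argument) that induces its norm. *)
Definition induces_norm (R : realType) (H : completeNormedModType R[i])
    (dot : {dot H for @Num.conj R[i]}) : Prop :=
  forall x : H, `|x| ^+ 2 = dot x x.

(* The norm of H takes values in R[i]; its values are real, so complex.Re only
   changes the type. *)
Definition opnorm (R : realType) (H : normedModType R[i]) (f : H -> H)
    : \bar R :=
  ereal_sup [set (complex.Re `|f x|)%:E | x in [set x : H | `|x| <= 1]].

Definition bounded_operator (R : realType) (H : normedModType R[i])
    (T : {linear H -> H}) : Prop :=
  (opnorm T < +oo)%E.

Definition power_bounded (R : realType) (H : normedModType R[i])
    (T : {linear H -> H}) : Prop :=
  (ereal_sup (range (fun n : nat => opnorm (iter n T))) < +oo)%E.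

(* T need not be invertible: a negative exponent gives the identity, by
   convention, and not a power of an inverse. *)
Definition zpower (H : Type) (T : H -> H) (k : int) : H -> H :=
  match k with
  | Posz n => iter n T
  | Negz _ => id
  end.

Definition expi2pi (R : realType) (t : R) : R[i] :=
  (cos (2 * pi * t) +i* sin (2 * pi * t))%C.

(* At N = 0 this is 0, since 0^-1 = 0; the limit is not affected. *)
Definition weighted_average (R : realType) (H : normedModType R[i])
    (T : {linear H -> H}) (p q : {poly R}) (N : nat) (x : H) : H :=
  (N%:R : R[i])^-1 *:
    \sum_(1 <= n < N.+1)
      expi2pi q.[n%:R] *: zpower T (Num.floor p.[n%:R]) x.

Definition sot_converges (R : realType) (H : normedModType R[i])
    (A : nat -> H -> H) : Prop :=
  exists S : {linear H -> H}, bounded_operator S /\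
    forall x : H, A N x @[N --> \oo] --> S x.

(* Main.v *)
From HB Require Import structures.
Require Import Defs.
From mathcomp Require Import ring lra zify.

Set Implicit Arguments.
Unset Strict Implicit.
Unset Printing Implicit Defensive.

Import Order.TTheory GRing.Theory Num.Theory.
Import numFieldNormedType.Exports.
Local Open Scope classical_set_scope.
Local Open Scope ring_scope.

(* On the closed span of the eigenvectors [T y = e(t) y] the averages become
   scalar sums of [e(q(n) + t [p(n)])]; these converge by Weyl's theorem, after
   passing to residue classes when the leading coefficient of [p] is rational and
   by Fejer approximation of the bracket when it is irrational.

   Every [x] is [y + z] with [y] in that span and with
   [1/N sum_(n < N) e(n t) T^n z -> 0] for all [t]: minimise over the span the
   asymptotic mean of [|T^u (x - y)|^2], a parallelogram functional which, by
   simultaneous recurrence, controls the norm on the span.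

   For such [z], [1/N sum_(n < N) c_n T^[p(n)] z -> 0] uniformly over all weights
   [|c_n| <= 1], by induction on the degree of [p]. In degree one this follows
   from a discrete Fourier transform and compactness of the circle. The inductive
   step is a van der Corput inequality in which contractivity and dilations are
   replaced by the trivial bound [|T^P y| <= M |T^u y|] for [u <= P]; the integer
   parts only cost a 0/1 error, which is absorbed by the arbitrary weights. *)

(** * Norms and scalar products *)

(** The obstacle is that [T] is in general neither a contraction nor invertible, so no spectral
    measure is at hand and the norms of an orbit may oscillate. The two summands of the
    decomposition need opposite treatments. On eigenvectors the limit may be nonzero, and the
    polynomial form of [q] matters, because [q(n) + t [p(n)]] is the phase of a scalar sum. On the
    complement [e(q(n))] is forgotten and becomes one weight among all. The class of all weights
    bounded by 1 is stable under everything that the induction does to it: the products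
    [c_(n+w) conj c_(n+w')] made by van der Corput differences, cut-offs, indicators of rounding
    errors, and averages over the fibres of [[p(n)]] in degree one. The price is paid in degree one:
    uniformity over the weights asks for uniformity in the frequency [t], hence the compactness
    argument. *)

Definition nrm (R : realType) (V : normedZmodType R[i]) (x : V) : R :=
  complex.Re `|x|.

Lemma nrmE (R : realType) (V : normedZmodType R[i]) (x : V) :
  `|x| = (nrm x)%:C%C.
Proof. by rewrite RRe_real// ger0_real. Qed.

Lemma nrm_ge0 (R : realType) (V : normedZmodType R[i]) (x : V) : 0 <= nrm x.
Proof. by rewrite -ler0c -nrmE. Qed.

Lemma nrmD (R : realType) (V : normedZmodType R[i]) (x y : V) :
  nrm (x + y) <= nrm x + nrm y.
Proof. by rewrite -lecR rmorphD/= -!nrmE ler_normD. Qed.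

Lemma nrmN (R : realType) (V : normedZmodType R[i]) (x : V) : nrm (- x) = nrm x.
Proof. by rewrite /nrm normrN. Qed.

Lemma nrmB (R : realType) (V : normedZmodType R[i]) (x y : V) :
  nrm (x - y) = nrm (y - x).
Proof. by rewrite -nrmN opprB. Qed.

Lemma nrm0 (R : realType) (V : normedZmodType R[i]) : nrm (0 : V) = 0.
Proof. by rewrite /nrm normr0. Qed.

Lemma nrm_eq0 (R : realType) (V : normedZmodType R[i]) (x : V) :
  (nrm x == 0) = (x == 0).
Proof. by rewrite -(inj_eq (@complexI R)) -nrmE rmorph0 normr_eq0. Qed.

Lemma nrmMn (R : realType) (V : normedZmodType R[i]) (x : V) n :
  nrm (x *+ n) = nrm x * n%:R.
Proof.
by apply: (@complexI R); rewrite -nrmE normrMn nrmE rmorphM/= rmorph_nat mulr_natr.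
Qed.

Lemma nrm_sum (R : realType) (V : normedZmodType R[i]) I (r : seq I)
    (P : pred I) (f : I -> V) :
  nrm (\sum_(i <- r | P i) f i) <= \sum_(i <- r | P i) nrm (f i).
Proof.
elim/big_ind2 : _ => [|x a y b xa yb|//]; first by rewrite nrm0.
exact: le_trans (nrmD _ _) (lerD xa yb).
Qed.

Lemma nrmM (R : realType) (x y : R[i]) : nrm (x * y) = nrm x * nrm y.
Proof. by apply: (@complexI R); rewrite -nrmE normrM !nrmE rmorphM. Qed.

Lemma nrm_real (R : realType) (x : R) : nrm (x%:C%C) = `|x|.
Proof. by rewrite /nrm normc_def/= expr0n/= addr0 sqrtr_sqr. Qed.

Lemma nrm_conj (R : realType) (x : R[i]) : nrm (Num.conj x) = nrm x.
Proof. by rewrite /nrm norm_conjC. Qed.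

Lemma Re_le_nrm (R : realType) (x : R[i]) : complex.Re x <= nrm x.
Proof. by apply: le_trans (ler_norm _) _; rewrite -lecR -nrmE normc_ge_Re. Qed.

Lemma nrmZ (R : realType) (V : normedModType R[i]) (a : R[i]) (x : V) :
  nrm (a *: x) = nrm a * nrm x.
Proof. by apply: (@complexI R); rewrite -nrmE normrZ !nrmE rmorphM. Qed.

Section dot_norm.
Context (R : realType) (H : completeNormedModType R[i]).
Context (dot : {dot H for @Num.conj R[i]}) (hdot : induces_norm dot).

Lemma dot_conj (x y : H) : dot x y = Num.conj (dot y x).
Proof. by rewrite hermC expr0 mul1r. Qed.

Lemma nrm_sqr (x : H) : nrm x ^+ 2 = complex.Re (dot x x).
Proof. by rewrite -hdot nrmE -rmorphXn. Qed.

Lemma nrm_sqrD (x y : H) :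
  nrm (x + y) ^+ 2 = nrm x ^+ 2 + nrm y ^+ 2 + 2 * complex.Re (dot x y).
Proof.
rewrite !nrm_sqr linearDl/= !linearDr/= (dot_conj y x).
by case: (dot x x) (dot x y) (dot y y) => [a b] [c d] [e f]; simpc => /=; ring.
Qed.

Lemma nrm_sqrB (x y : H) :
  nrm (x - y) ^+ 2 = nrm x ^+ 2 + nrm y ^+ 2 - 2 * complex.Re (dot x y).
Proof. by rewrite nrm_sqrD nrmN linearNr/= raddfN/=; ring. Qed.

Lemma parallelogram (x y : H) :
  nrm (x + y) ^+ 2 + nrm (x - y) ^+ 2 = 2 * nrm x ^+ 2 + 2 * nrm y ^+ 2.
Proof. by rewrite nrm_sqrD nrm_sqrB; ring. Qed.

Lemma dotZ (a b : R[i]) (x y : H) :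
  dot (a *: x) (b *: y) = a * Num.conj b * dot x y.
Proof. by rewrite linearZl_LR linearZr_LR/= mulrA. Qed.

Lemma dot_le (x y : H) : nrm (dot x y) <= nrm x * nrm y.
Proof.
have [->|y0] := eqVneq y 0; first by rewrite linear0r !nrm0 mulr0.
have Y0 : 0 < nrm y ^+ 2 by rewrite exprn_gt0// lt_def nrm_eq0 y0 nrm_ge0.
rewrite -(@ler_pXn2r _ 2)// ?nnegrE ?nrm_ge0 ?mulr_ge0 ?nrm_ge0//.
(* Cauchy-Schwarz: this vector is [nrm y ^+ 2] times the component of [x] orthogonal to [y]; the
   scaling avoids a division. *)
have := sqr_ge0 (nrm ((nrm y ^+ 2)%:C%C *: x - dot x y *: y)).
rewrite nrm_sqrB !nrmZ dotZ nrm_real -mulrA -normCKC nrmE.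
have -> : complex.Re ((nrm y ^+ 2)%:C%C * (nrm (dot x y))%:C%C ^+ 2) =
    nrm y ^+ 2 * nrm (dot x y) ^+ 2 by rewrite -rmorphXn -rmorphM.
rewrite ger0_norm ?exprn_ge0 ?nrm_ge0// => h.
by rewrite -(ler_pM2l Y0); nra.
Qed.

Lemma dot_suml I (r : seq I) (P : pred I) (f : I -> H) y :
  dot (\sum_(i <- r | P i) f i) y = \sum_(i <- r | P i) dot (f i) y.
Proof. exact: linear_sumlz. Qed.

Lemma dot_sumr I (r : seq I) (P : pred I) (f : I -> H) y :
  dot y (\sum_(i <- r | P i) f i) = \sum_(i <- r | P i) dot y (f i).
Proof. exact: linear_sumr. Qed.

End dot_norm.

(** * Exponentials *)

Lemma e2piD (R : realType) (s t : R) :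
  expi2pi (s + t) = expi2pi s * expi2pi t.
Proof. by rewrite /expi2pi mulrDr cosD sinD; simpc; congr Complex; ring. Qed.

Lemma e2pi0 (R : realType) : expi2pi (0 : R) = 1.
Proof. by rewrite /expi2pi mulr0 cos0 sin0. Qed.

Lemma e2pi1 (R : realType) : expi2pi (1 : R) = 1.
Proof. by rewrite /expi2pi mulr1 mulr_natl cos2pi sin2pi. Qed.

Lemma e2piN (R : realType) (t : R) : expi2pi (- t) = Num.conj (expi2pi t).
Proof. by rewrite /expi2pi mulrN cosN sinN. Qed.

Lemma e2pi_conjM (R : realType) (t : R) :
  expi2pi t * Num.conj (expi2pi t) = 1.
Proof. by rewrite -e2piN -e2piD subrr e2pi0. Qed.

Lemma nrm_e2pi (R : realType) (t : R) : nrm (expi2pi t) = 1.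
Proof.
apply/eqP; rewrite -(@eqrXn2 _ 2) ?nrm_ge0// expr1n; apply/eqP.
by apply: (@complexI R); rewrite rmorphXn/= -nrmE normCK e2pi_conjM.
Qed.

Lemma e2pi_nat (R : realType) (t : R) n : expi2pi (t * n%:R) = expi2pi t ^+ n.
Proof.
elim: n => [|n ih]; first by rewrite mulr0 e2pi0 expr0.
by rewrite -natr1 mulrDr mulr1 e2piD ih exprSr.
Qed.

Lemma e2pi_int (R : realType) (m : int) : expi2pi (m%:~R : R) = 1.
Proof.
have e2pi_natr n : expi2pi (n%:R : R) = 1.
  by rewrite -[n%:R]mul1r e2pi_nat e2pi1 expr1n.
case: m => n; first exact: e2pi_natr.
by rewrite NegzE mulrNz e2piN e2pi_natr rmorph1.
Qed.

Lemma e2pi_Num_int (R : realType) (t : R) : t \is a Num.int -> expi2pi t = 1.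
Proof. by move=> /intrP[m ->]; exact: e2pi_int. Qed.

Lemma cos_lip (R : realType) (a b : R) : `|cos a - cos b| <= `|a - b|.
Proof.
wlog ab : a b / b < a.
  move=> h; have [ab|ba|->] := ltgtP a b; last by rewrite !subrr normr0.
    by rewrite distrC [leRHS]distrC; exact: h.
  exact: h.
have [c _ ->] := @MVT R cos (fun x => - sin x) b a ab
  (fun x _ => is_derive_cos x) (continuous_subspaceT (@continuous_cos R)).
by rewrite normrM normrN ler_piMl ?sin_max.
Qed.

Lemma sin_lip (R : realType) (a b : R) : `|sin a - sin b| <= `|a - b|.
Proof. by rewrite -!cosBpihalf (le_trans (cos_lip _ _))// opprB addrA subrK. Qed.

(** The constant is twice [2 * pi] because real and imaginary parts are estimated separately. *)
Lemma e2pi_lip (R : realType) (s t : R) :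
  nrm (expi2pi s - expi2pi t) <= 4 * pi * `|s - t|.
Proof.
have h : `|2 * pi * s - 2 * pi * t| = 2 * pi * `|s - t|.
  by rewrite -mulrBr normrM ger0_norm// mulr_ge0// pi_ge0.
have := cos_lip (2 * pi * s) (2 * pi * t).
have := sin_lip (2 * pi * s) (2 * pi * t); rewrite !h => hs hc.
rewrite /expi2pi; set c := cos _ - _ in hc *; set d := sin _ - _ in hs *.
have -> : (cos (2 * pi * s) +i* sin (2 * pi * s) -
   cos (2 * pi * t) +i* sin (2 * pi * t))%C = (c%:C + 'i * d%:C)%C.
  by rewrite /c /d; simpc.
apply: le_trans (nrmD _ _) _; rewrite nrmM !nrm_real.
have -> : nrm 'i%C = 1 :> R by rewrite /nrm normc_def/= expr0n/= expr1n add0r sqrtr1.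
by lra.
Qed.

Lemma nrm_e2piB1 (R : realType) (t : R) :
  nrm (expi2pi t - 1) ^+ 2 = 2 - 2 * cos (2 * pi * t).
Proof.
rewrite /nrm normc_def/= sqr_sqrtr ?addr_ge0 ?sqr_ge0//.
have := cos2Dsin2 (2 * pi * t); set c := cos _; set d := sin _ => h.
by rewrite subr0; nra.
Qed.

(** The hypothesis keeps [s] at distance at least [h] from the integers -1, 0 and 1. Parity and the
    reflection of [|s|] to [1 - |s|] reduce to [[0, 1/2]], where the cosine decreases. *)
Lemma cos_le_away (R : realType) (h s : R) : 0 <= h <= 2^-1 ->
  h <= `|s| <= 1 - h -> cos (2 * pi * s) <= cos (2 * pi * h).
Proof.
move=> /andP[h0 h1] /andP[hs sh]; have p0 := pi_gt0 R.
have -> : cos (2 * pi * s) = cos (2 * pi * `|s|).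
  by rewrite -cos_norm !normrM (ger0_norm (pi_ge0 R)) ger0_norm.
have mono (a b : R) : 0 <= a <= 2^-1 -> 0 <= b <= 2^-1 -> a <= b ->
    cos (2 * pi * b) <= cos (2 * pi * a).
  move=> /andP[a0 a1] /andP[b0 b1] ab.
  rewrite leNgt ltr_cos ?in_itv/= -?leNgt; [by nra|..].
    by apply/andP; split; nra.
  by apply/andP; split; nra.
have [s2|s2] := leP `|s| 2^-1; first by apply: mono => //; lra.
rewrite -(cosN (2 * pi * `|s|)) -cosD2pi -[pi *+ 2]mulr_natl.
have -> : - (2 * pi * `|s|) + 2 * pi = 2 * pi * (1 - `|s|) by ring.
by apply: mono; lra.
Qed.

Lemma cos_lt1 (R : realType) (h : R) : 0 < h <= 2^-1 -> cos (2 * pi * h) < 1.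
Proof.
move=> /andP[h0 h1]; have p0 := pi_gt0 R.
by rewrite -[ltRHS]cos0 ltr_cos ?in_itv/= ?lexx ?pi_ge0//; [nra|apply/andP; split; nra].
Qed.

Lemma e2pi_eq1 (R : realType) (t : R) : expi2pi t = 1 -> t \is a Num.int.
Proof.
move=> et; have /andP[f0 f1] := floor_itv t; rewrite intrD in f1.
set f := t - (Num.floor t)%:~R.
have ef : cos (2 * pi * f) = 1.
  have : expi2pi f = 1 by rewrite e2piD et -mulrNz e2pi_int mulr1.
  by move/(congr1 (@complex.Re R)).
have [f00|/negbTE fn0] := eqVneq f 0.
  by rewrite -(subr0 t) -f00 opprB addrC subrK intr_int.
have f_gt0 : 0 < f by rewrite lt_def fn0 /f subr_ge0.
have lt1 : f < 1 by rewrite /f; lra.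
have [f2|f2] := leP f 2^-1.
  by have := @cos_lt1 R f; rewrite f_gt0 f2 ef ltxx => /(_ isT).
have /cos_lt1 : 0 < 1 - f <= 2^-1 by apply/andP; split; lra.
have : cos (2 * pi * f) <= cos (2 * pi * (1 - f)).
  by apply: cos_le_away; rewrite ?ger0_norm//; lra.
by rewrite ef => /le_lt_trans h /h; rewrite ltxx.
Qed.

Lemma sum_e2pi_roots (R : realType) (t : R) n :
  t * n%:R \is a Num.int -> t \isn't a Num.int ->
  \sum_(k < n) expi2pi (t * k%:R) = 0.
Proof.
move=> tn tN.
have t1 : expi2pi t - 1 != 0.
  by rewrite subr_eq0; apply/eqP => /e2pi_eq1 h; rewrite h in tN.
apply: (mulfI t1); rewrite mulr0.
under eq_bigr do rewrite e2pi_nat.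
by rewrite -subrX1 -e2pi_nat e2pi_Num_int// subrr.
Qed.

(** * Uniformly null means *)

Lemma near_forall_lt (P : nat -> nat -> Prop) W :
  (forall w, (w < W)%N -> \forall N \near \oo, P w N) ->
  \forall N \near \oo, forall w, (w < W)%N -> P w N.
Proof.
elim: W => [_|W ih h]; first by near=> N.
have {}ih : \forall N \near \oo, forall w, (w < W)%N -> P w N.
  by apply: ih => w wW; apply: h; rewrite ltnS ltnW.
have hW := h W (ltnSn W).
near=> N => w; rewrite ltnS leq_eqVlt => /predU1P[->|].
  by near: N.
by move: w; near: N.
Unshelve. all: by end_near. Qed.

Lemma sum_sqr_le (R : realType) (x : nat -> R) N :
  (\sum_(0 <= n < N) x n) ^+ 2 <= N%:R * \sum_(0 <= n < N) x n ^+ 2.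
Proof.
elim: N => [|N ih]; first by rewrite !big_geq// expr0n mulr0.
rewrite !big_nat_recr//= -natr1.
move: ih; set S := \sum_(_ <= _ < _) _; set Q := \sum_(_ <= _ < _) _ => ih.
have Q0 : 0 <= Q by apply: sumr_ge0 => i _; exact: sqr_ge0.
have [N0|N0] := eqVneq N 0%N.
  move: ih; rewrite N0 mul0r => ih.
  have S0 : S = 0 by apply/eqP; rewrite -sqrf_eq0 eq_le ih sqr_ge0.
  by rewrite S0; lra.
have {N0} N1 : 0 < N%:R :> R by rewrite ltr0n lt0n.
rewrite -(ler_pM2l N1); have := sqr_ge0 (S - N%:R * x N).
have : (N%:R + 1) * S ^+ 2 <= (N%:R + 1) * (N%:R * Q) by rewrite ler_wpM2l; lra.
by lra.
Qed.

Lemma nat_sumD (V : nmodType) (f : nat -> V) m n :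
  \sum_(0 <= i < m + n) f i =
  \sum_(0 <= i < m) f i + \sum_(0 <= i < n) f (m + i)%N.
Proof.
rewrite (big_cat_nat (n := m)) ?leq_addr//=; congr (_ + _).
rewrite -{1}[m]add0n big_addn addnC addnK.
by apply: eq_bigr => i _; rewrite addnC.
Qed.

Lemma nat_sum_delta (V : nmodType) (f : nat -> V) l L : (l < L)%N ->
  \sum_(0 <= k < L) (if k == l then f k else 0) = f l.
Proof.
move=> lL; rewrite (bigD1_seq l) ?mem_index_iota ?iota_uniq//= eqxx.
by rewrite big1 ?addr0// => k /negbTE ->.
Qed.

Lemma nat_sum_shift (V : zmodType) (f : nat -> V) N i :
  \sum_(0 <= n < N) f n - \sum_(0 <= n < N) f (n + i)%N =
  \sum_(0 <= n < i) f n - \sum_(0 <= n < i) f (N + n)%N.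
Proof.
have h : \sum_(0 <= n < N) f n + \sum_(0 <= n < i) f (N + n)%N =
    \sum_(0 <= n < i) f n + \sum_(0 <= n < N) f (n + i)%N.
  rewrite -nat_sumD addnC nat_sumD; congr (_ + _).
  by apply: eq_bigr => n _; rewrite addnC.
by apply/eqP; rewrite subr_eq addrAC eq_sym subr_eq -h.
Qed.

Lemma nrm_nat_sum (R : realType) (V : normedZmodType R[i]) (a : nat -> V) B N :
  (forall n, (n < N)%N -> nrm (a n) <= B) ->
  nrm (\sum_(0 <= n < N) a n) <= B * N%:R.
Proof.
move=> aB; apply: le_trans (nrm_sum _ _ _) _.
rewrite big_nat; apply: le_trans (ler_sum _ (fun n h => aB n _)) _ => //.
by rewrite -big_nat sumr_const_nat subn0 mulr_natr.
Qed.

(** Shifting the range of summation by [w < W] costs [2 w] boundary terms. Adding up all [W] shifts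
    turns [W] copies of the sum into a sum over windows, at a total cost of at most [2 W^2 B]. *)
Lemma nrm_window (R : realType) (V : normedZmodType R[i]) (a : nat -> V) B N W :
  (forall n, nrm (a n) <= B) ->
  W%:R * nrm (\sum_(0 <= n < N) a n) <=
  \sum_(0 <= n < N) nrm (\sum_(0 <= w < W) a (n + w)%N) + 2 * W%:R ^+ 2 * B.
Proof.
move=> aB; have B0 : 0 <= B by apply: le_trans (nrm_ge0 _) (aB 0%N).
rewrite mulrC -nrmMn.
set S := \sum_(0 <= n < N) a n.
have -> : S *+ W = \sum_(0 <= n < N) \sum_(0 <= w < W) a (n + w)%N +
    \sum_(0 <= w < W) (\sum_(0 <= n < w) a n - \sum_(0 <= n < w) a (N + n)%N).
  rewrite exchange_big/= -big_split/=.
  rewrite (_ : S *+ W = \sum_(0 <= w < W) S); last by rewrite sumr_const_nat subn0.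
  apply: eq_bigr => w _.
  by rewrite -nat_sum_shift addrC subrK.
apply: le_trans (nrmD _ _) _; rewrite lerD ?nrm_sum//.
have -> : 2 * W%:R ^+ 2 * B = 2 * W%:R * B * W%:R by ring.
apply: nrm_nat_sum => w wW.
apply: le_trans (nrmD _ _) _; rewrite nrmN.
have wW' : w%:R * B <= W%:R * B by rewrite ler_wpM2r// ler_nat ltnW.
have := @nrm_nat_sum _ _ a B w (fun n _ => aB n).
have := @nrm_nat_sum _ _ (fun n => a (N + n)%N) B w (fun n _ => aB _).
by lra.
Qed.

(** The index [c] makes room for uniformity over all weights; a single sequence is indexed by
    [unit]. *)
Definition mnull (R : realType) (V : normedZmodType R[i]) (I : Type)
    (D : set I) (a : I -> nat -> V) :=
  forall e : R, 0 < e -> \forall N \near \oo, forall c, D c ->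
    nrm (\sum_(0 <= n < N) a c n) <= e * N%:R.

Lemma eq_mnull (R : realType) (V : normedZmodType R[i]) (I : Type)
    (D : set I) (a b : I -> nat -> V) :
  (forall c n, a c n = b c n) -> mnull D a -> mnull D b.
Proof.
move=> ab h e e0; have := h e e0; apply: filterS => N hN c /hN.
by under eq_bigr do rewrite ab.
Qed.

(** Cauchy-Schwarz over [n] replaces the norms of the window sums by their squares, which can be
    expanded. One half of [e] goes there, the other half to the boundary terms of [nrm_window]. *)
Lemma mnull_window (R : realType) (V : normedZmodType R[i]) (I : Type)
    (D : set I) (a : I -> nat -> V) B :
  (forall c n, D c -> nrm (a c n) <= B) ->
  (forall e : R, 0 < e -> exists2 W, (0 < W)%N & \forall N \near \oo,
    forall c, D c ->
    \sum_(0 <= n < N) nrm (\sum_(0 <= w < W) a c (n + w)%N) ^+ 2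
    <= e * W%:R ^+ 2 * N%:R) ->
  mnull D a.
Proof.
move=> aB h e e0.
have [W W0 hW] := h ((e / 2) ^+ 2) ltac:(by rewrite exprn_gt0// divr_gt0).
have W0' : 0 < W%:R :> R by rewrite ltr0n.
near=> N => c Dc.
have h1 : \sum_(0 <= n < N) nrm (\sum_(0 <= w < W) a c (n + w)%N) <=
    e / 2 * W%:R * N%:R.
  rewrite -(@ler_pXn2r _ 2)// ?nnegrE; last 2 first.
  - by apply: sumr_ge0 => ? _; exact: nrm_ge0.
  - by rewrite !mulr_ge0 ?invr_ge0// ltW.
  apply: le_trans (sum_sqr_le _ _) _.
  have : \sum_(0 <= n < N) nrm (\sum_(0 <= w < W) a c (n + w)%N) ^+ 2
      <= (e / 2) ^+ 2 * W%:R ^+ 2 * N%:R.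
    by move: c Dc; near: N; exact: hW.
  move=> /(ler_wpM2l (ler0n R N))/le_trans; apply.
  by rewrite le_eqVlt; apply/orP; left; apply/eqP; ring.
have h2 : 2 * W%:R ^+ 2 * B <= e / 2 * W%:R * N%:R.
  have : 2 * W%:R ^+ 2 * B / (e / 2 * W%:R) <= N%:R.
    by near: N; exact: nbhs_infty_ger.
  by rewrite ler_pdivrMr ?mulr_gt0 ?divr_gt0// [leRHS]mulrC.
rewrite -(ler_pM2l W0').
apply: le_trans (nrm_window _ _ (fun n => aB c n Dc)) _.
by lra.
Unshelve. all: by end_near. Qed.

(** Bookkeeping for an expanded square: each of the [W] diagonal pairs costs a full [x], and every
    pair may cost [x / W]. The total is linear in [W], against a trivial bound of order [W^2]. *)
Lemma sum_diagonal (R : numFieldType) W (x : R) : (0 < W)%N ->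
  \sum_(0 <= w < W) \sum_(0 <= w' < W) ((w == w')%:R * x + W%:R^-1 * x) =
  2 * (W%:R * x).
Proof.
move=> W0; have W0' : W%:R != 0 :> R by rewrite pnatr_eq0 -lt0n.
have hs w : (w < W)%N ->
    \sum_(0 <= w' < W) ((w == w')%:R * x + W%:R^-1 * x) = 2 * x.
  move=> wW; rewrite big_split/= sumr_const_nat subn0 -mulr_suml.
  rewrite (bigD1_seq w) ?mem_index_iota ?iota_uniq//= eqxx big1 ?addr0; last first.
    by move=> i; rewrite eq_sym => /negbTE ->.
  by rewrite -[_ * _ *+ W]mulr_natr [_ * x * W%:R]mulrAC mulVf//= mulr1n; ring.
rewrite big_nat (eq_bigr (fun=> 2 * x)); last by move=> w /andP[_]; exact: hs.
by rewrite -big_nat sumr_const_nat subn0 -[_ *+ W]mulr_natr; ring.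
Qed.

(** Van der Corput's lemma: in the mean square of a window sum only the diagonal pairs survive, so
    it is at most [2 W N], which is below [e W^2 N] once [W >= 2 / e]. *)
Lemma vdc_scalar (R : realType) (a : nat -> R[i]) :
  (forall n, nrm (a n) <= 1) ->
  (forall w w', (w' < w)%N ->
    mnull setT (fun (_ : unit) n => a (n + w)%N * Num.conj (a (n + w')%N))) ->
  mnull setT (fun _ : unit => a).
Proof.
move=> a1 h; apply: (mnull_window (B := 1)) => // e e0.
pose W := (Num.truncn (2 / e)).+1.
have W0 : 0 < W%:R :> R by rewrite ltr0n.
have eW : 2 <= e * W%:R.
  by rewrite mulrC -ler_pdivrMr// ltW// truncnS_gt.
exists W => //.
have hW : \forall N \near \oo, forall w, (w < W)%N -> forall w', (w' < W)%N ->
  complex.Re (\sum_(0 <= n < N) a (n + w)%N * Num.conj (a (n + w')%N)) <=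
  (w == w')%:R * N%:R + W%:R^-1 * N%:R.
  apply: near_forall_lt => w wW; apply: near_forall_lt => w' wW'.
  have Wi : 0 < W%:R^-1 :> R by rewrite invr_gt0.
  case: (ltngtP w w') => [ww'|ww'|<-].
  - have := h _ _ ww' _ Wi; apply: filterS => N /(_ tt Logic.I).
    rewrite mul0r add0r; apply: le_trans; apply: le_trans (Re_le_nrm _) _.
    rewrite -nrm_conj rmorph_sum/=.
    by under eq_bigr do rewrite rmorphM/= conjCK mulrC.
  - have := h _ _ ww' _ Wi; apply: filterS => N /(_ tt Logic.I).
    rewrite mul0r add0r; apply: le_trans; exact: Re_le_nrm.
  - near=> N; apply: le_trans (Re_le_nrm _) _; rewrite mul1r.
    rewrite -[leLHS]addr0 lerD ?mulr_ge0//.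
    rewrite -[leRHS]mul1r; apply: nrm_nat_sum => n _.
    by rewrite nrmM nrm_conj -[leRHS]mulr1 ler_pM ?nrm_ge0.
near=> N => _ _.
have -> : \sum_(0 <= n < N) nrm (\sum_(0 <= w < W) a (n + w)%N) ^+ 2 =
    \sum_(0 <= w < W) \sum_(0 <= w' < W)
      complex.Re (\sum_(0 <= n < N) a (n + w)%N * Num.conj (a (n + w')%N)).
  under [RHS]eq_bigr => w _ do
    (under eq_bigr => w' _ do rewrite raddf_sum/=; rewrite exchange_big/=).
  rewrite exchange_big/=; apply: eq_bigr => n _.
  rewrite (_ : _ ^+ 2 = complex.Re (`|\sum_(0 <= w < W) a (n + w)%N| ^+ 2)); last first.
    by rewrite nrmE -rmorphXn.
  rewrite normCK rmorph_sum mulr_suml raddf_sum/=; apply: eq_bigr => w _.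
  by rewrite mulr_sumr raddf_sum.
apply: (@le_trans _ _ (\sum_(0 <= w < W) \sum_(0 <= w' < W)
   ((w == w')%:R * N%:R + W%:R^-1 * N%:R))).
  rewrite big_nat [leRHS]big_nat; apply: ler_sum => w /andP[_ wW].
  rewrite big_nat [leRHS]big_nat; apply: ler_sum => w' /andP[_ wW'].
  by move: w wW w' wW'; near: N; exact: hW.
rewrite sum_diagonal//.
have N0 : 0 <= N%:R :> R by [].
have : 2 * (W%:R * N%:R) <= e * W%:R * (W%:R * N%:R).
  by rewrite ler_wpM2r// mulr_ge0// ltW.
by lra.
Unshelve. all: by end_near. Qed.

(** * Weyl sums *)

Lemma coef_XaddC_exp_lt (R : comNzRingType) (c : R) i n :
  (i < n)%N -> (('X + c%:P) ^+ i)`_n = 0.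
Proof.
move=> ni; rewrite nth_default//; apply: leq_trans (size_poly_exp_leq _ _) _.
by rewrite size_XaddC mul1n.
Qed.

Lemma coef_XaddC_exp (R : comNzRingType) (c : R) i :
  (('X + c%:P) ^+ i)`_i = 1.
Proof.
elim: i => [|i ih]; first by rewrite expr0 coef1.
by rewrite exprSr mulrDr coefD coefMX coefMC/= ih coef_XaddC_exp_lt// mul0r addr0.
Qed.

Lemma coef_XaddC_exp_pred (R : comNzRingType) (c : R) i :
  (('X + c%:P) ^+ i.+1)`_i = i.+1%:R * c.
Proof.
elim: i => [|i ih].
  by rewrite expr1 coefD coefX coefC/= add0r mul1r.
rewrite exprSr mulrDr coefD coefMX coefMC/= ih coef_XaddC_exp mul1r.
by rewrite -[i.+2%:R]natr1 mulrDl mul1r.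
Qed.

Lemma size_sub_lead (R : nzRingType) (p : {poly R}) d : size p = d.+1 ->
  (size (p - lead_coef p *: 'X^d)%R <= d)%N.
Proof.
move=> sp; apply/leq_sizeP => j dj; rewrite coefB coefZ coefXn.
have [->|jd] := eqVneq j d; first by rewrite lead_coefE sp mulr1 subrr.
by rewrite mulr0 subr0 nth_default// sp ltn_neqAle eq_sym jd.
Qed.

Definition shift_poly (R : comNzRingType) (p : {poly R}) w :=
  p \Po ('X + w%:R%:P).

Lemma horner_shift_poly (R : comNzRingType) (p : {poly R}) w n :
  (shift_poly p w).[n%:R] = p.[(n + w)%N%:R].
Proof. by rewrite /shift_poly horner_comp hornerD hornerX hornerC natrD. Qed.

Lemma coef_shift_top (R : comNzRingType) (p : {poly R}) w d n :
  size p = d.+2 -> (d < n)%N -> (shift_poly p w)`_n = p`_n.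
Proof.
move=> sp dn; rewrite coef_comp_poly sp.
have [nd|nd] := ltnP n d.+2; last first.
  rewrite big1 ?nth_default ?sp// => i _.
  by rewrite coef_XaddC_exp_lt ?mulr0// (leq_trans (ltn_ord i)).
have -> : n = d.+1 by apply/eqP; rewrite eqn_leq -ltnS nd dn.
rewrite big_ord_recr/= coef_XaddC_exp mulr1 big1 ?add0r// => i _.
by rewrite coef_XaddC_exp_lt ?mulr0.
Qed.

Lemma coef_shift_pred (R : comNzRingType) (p : {poly R}) w d :
  size p = d.+2 ->
  (shift_poly p w)`_d = p`_d + p`_d.+1 * (d.+1%:R * w%:R).
Proof.
move=> sp; rewrite coef_comp_poly sp 2!big_ord_recr/=.
rewrite coef_XaddC_exp mulr1 coef_XaddC_exp_pred big1 ?add0r// => i _.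
by rewrite coef_XaddC_exp_lt ?mulr0.
Qed.

(** Both van der Corput inductions rest on this: the leading coefficient is multiplied by a positive
    integer, so irrationality and positivity are inherited by the difference. *)
Lemma diff_shift_poly (R : numDomainType) (p : {poly R}) w w' d :
  size p = d.+2 -> (w' < w)%N ->
  size (shift_poly p w - shift_poly p w') = d.+1 /\
  lead_coef (shift_poly p w - shift_poly p w') =
  lead_coef p * (d.+1 * (w - w'))%:R.
Proof.
move=> sp ww'; set r := _ - _.
have rd : r`_d = lead_coef p * (d.+1 * (w - w'))%:R.
  rewrite coefB !coef_shift_pred// lead_coefE sp/= natrM natrB ?(ltnW ww')//.
  by ring.
have r0 : r`_d != 0.
  rewrite rd mulf_neq0 ?lead_coef_eq0 -?size_poly_eq0 ?sp//.
  by rewrite pnatr_eq0 muln_eq0/= subn_eq0 -ltnNge.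
have sr : size r = d.+1.
  apply/eqP; rewrite eqn_leq; apply/andP; split.
    apply/leq_sizeP => j dj.
    by rewrite coefB !(coef_shift_top _ sp dj) subrr.
  rewrite ltnNge; apply: contra r0 => sr.
  by rewrite nth_default.
by rewrite sr -rd lead_coefE sr.
Qed.

Lemma size2_horner (R : nzRingType) (p : {poly R}) x : size p = 2%N ->
  p.[x] = p`_0 + lead_coef p * x.
Proof.
move=> sp; rewrite horner_coef sp 2!big_ord_recr/= big_ord0 add0r.
by rewrite expr0 mulr1 expr1 lead_coefE sp.
Qed.

Lemma size1_horner (R : nzRingType) (p : {poly R}) x : (size p <= 1)%N ->
  p.[x] = p`_0.
Proof. by move=> /size1_polyC ->; rewrite hornerC coefC. Qed.

(** In degree one the sum is geometric, and multiplication by the nonzero [expi2pi al - 1] leaves a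
    term of norm at most 2. Higher degrees follow by differencing. *)
Lemma weyl_irrational (R : realType) d (p : {poly R}) : size p = d.+2 ->
  (forall b, (0 < b)%N -> lead_coef p * b%:R \isn't a Num.int) ->
  mnull setT (fun (_ : unit) n => expi2pi p.[n%:R]).
Proof.
elim: d p => [|d ih] p sp irr.
  move=> e e0; set al := lead_coef p in irr.
  have al1 : expi2pi al - 1 != 0.
    rewrite subr_eq0; apply/eqP => /e2pi_eq1 h.
    by have := irr 1%N isT; rewrite mulr1 h.
  have n0 : 0 < nrm (expi2pi al - 1) by rewrite lt_def nrm_eq0 al1 nrm_ge0.
  near=> N => _ _; rewrite -(ler_pM2l n0) -nrmM.
  rewrite (eq_bigr (fun i => expi2pi p`_0 * expi2pi al ^+ i)); last first.
    by move=> i _; rewrite size2_horner// e2piD e2pi_nat.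
  rewrite -mulr_sumr mulrCA big_mkord -subrX1 nrmM nrm_e2pi mul1r.
  apply: le_trans (nrmD _ _) _; rewrite nrmN -e2pi_nat nrm_e2pi.
  have -> : nrm (1 : R[i]) = 1 by rewrite -(e2pi0 R) nrm_e2pi.
  rewrite mulrA -ler_pdivrMl ?mulr_gt0//.
  by near: N; exact: nbhs_infty_ger.
apply: vdc_scalar => [n|w w' ww']; first by rewrite nrm_e2pi.
have [sr lr] := diff_shift_poly sp ww'.
have h : mnull setT (fun (_ : unit) n =>
    expi2pi (shift_poly p w - shift_poly p w').[n%:R]).
  apply: ih => // b b0; rewrite lr -mulrA -natrM; apply: irr.
  by rewrite muln_gt0 b0 muln_gt0 subn_gt0 ww'.
apply: eq_mnull h => _ n.
by rewrite -e2piN -e2piD hornerD hornerN !horner_shift_poly.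
Unshelve. all: by end_near. Qed.

(* [l] depends on [e], so that no completeness of [V] is needed. *)
Definition mcauchy (R : realType) (V : normedZmodType R[i]) (a : nat -> V) :=
  forall e : R, 0 < e -> exists l : V, \forall N \near \oo,
    nrm (\sum_(0 <= n < N) a n - l *+ N) <= e * N%:R.

Lemma mcauchy_approx (R : realType) (V : normedZmodType R[i]) (a : nat -> V) :
  (forall e : R, 0 < e -> exists2 b, mcauchy b & \forall N \near \oo,
    nrm (\sum_(0 <= n < N) (a n - b n)) <= e * N%:R) -> mcauchy a.
Proof.
move=> h e e0; have e2 : 0 < e / 2 by rewrite divr_gt0.
have [b /(_ _ e2)[l hl] hb] := h _ e2; exists l; near=> N.
have -> : \sum_(0 <= n < N) a n - l *+ N =
    \sum_(0 <= n < N) (a n - b n) + (\sum_(0 <= n < N) b n - l *+ N).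
  by rewrite sumrB addrA subrK.
apply: le_trans (nrmD _ _) _; rewrite [e in leRHS](splitr e) mulrDl.
by apply: lerD; near: N.
Unshelve. all: by end_near. Qed.

Lemma mnull_mcauchy (R : realType) (V : normedZmodType R[i]) (a : nat -> V) :
  mnull setT (fun _ : unit => a) -> mcauchy a.
Proof.
move=> h e e0; exists 0; have := h e e0; apply: filterS => N /(_ tt Logic.I).
by rewrite mul0rn subr0.
Qed.

Lemma eq_mcauchy (R : realType) (V : normedZmodType R[i]) (a b : nat -> V) :
  a =1 b -> mcauchy a -> mcauchy b.
Proof. by move=> /funext ->. Qed.

Lemma mcauchyD (R : realType) (V : normedZmodType R[i]) (a b : nat -> V) :
  mcauchy a -> mcauchy b -> mcauchy (fun n => a n + b n).
Proof.
move=> ha hb e e0; have e2 : 0 < e / 2 by rewrite divr_gt0.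
have [[l hl] [m hm]] := (ha _ e2, hb _ e2); exists (l + m); near=> N.
rewrite big_split/= mulrnDl opprD addrACA.
apply: le_trans (nrmD _ _) _; rewrite [e in leRHS](splitr e) mulrDl.
by apply: lerD; near: N.
Unshelve. all: by end_near. Qed.

Lemma mcauchy0 (R : realType) (V : normedZmodType R[i]) :
  mcauchy (fun=> 0 : V).
Proof.
move=> e e0; exists 0; near=> N.
by rewrite big1 ?mul0rn ?subrr ?nrm0 ?mulr_ge0// ltW.
Unshelve. all: by end_near. Qed.

Lemma mcauchy_sum (R : realType) (V : normedZmodType R[i]) I (r : seq I)
    (a : I -> nat -> V) :
  (forall i, mcauchy (a i)) -> mcauchy (fun n => \sum_(i <- r) a i n).
Proof.
move=> h; elim: r => [|i r ih].
  by apply: eq_mcauchy (@mcauchy0 _ _) => n; rewrite big_nil.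
by apply: eq_mcauchy (mcauchyD (h i) ih) => n; rewrite big_cons.
Qed.

Lemma mcauchy_morph (R : realType) (V W : normedZmodType R[i])
    (f : V -> W) c (a : nat -> V) : zmod_morphism f ->
  (forall x, nrm (f x) <= c * nrm x) -> mcauchy a -> mcauchy (fun n => f (a n)).
Proof.
move=> fadd fc ha e e0.
pose F : {additive V -> W} := HB.pack f (GRing.isZmodMorphism.Build V W f fadd).
have c0 : 0 < `|c| + 1 by rewrite ltr_wpDl.
have [l hl] := ha (e / (`|c| + 1)) ltac:(by rewrite divr_gt0).
exists (f l); near=> N; rewrite -(raddf_sum F) -(raddfMn F) -(raddfB F).
have hN : nrm (\sum_(0 <= n < N) a n - l *+ N) <= e / (`|c| + 1) * N%:R.
  by near: N.
apply: le_trans (fc _) _; apply: le_trans (ler_wpM2r (nrm_ge0 _) (_ : c <= `|c| + 1)) _.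
  by rewrite (le_trans (ler_norm c))// lerDl.
by rewrite mulrC -ler_pdivlMr// mulrAC.
Unshelve. all: by end_near. Qed.

Lemma mcauchyZ (R : realType) (c : R[i]) (a : nat -> R[i]) :
  mcauchy a -> mcauchy (fun n => c * a n).
Proof.
apply: (mcauchy_morph (f := fun x => c * x) (c := nrm c)) => [x y|x].
  exact: mulrBr.
by rewrite nrmM.
Qed.

Lemma mcauchy_scale (R : realType) (V : normedModType R[i]) (a : nat -> R[i])
    (v : V) : mcauchy a -> mcauchy (fun n => a n *: v).
Proof.
apply: (mcauchy_morph (f := fun x => x *: v) (c := nrm v)) => [x y|x].
  exact: scalerBl.
by rewrite nrmZ mulrC.
Qed.

Lemma nat_sumM (V : nmodType) (f : nat -> V) b N :
  \sum_(0 <= n < N * b) f n =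
  \sum_(0 <= r < b) \sum_(0 <= k < N) f (k * b + r)%N.
Proof.
elim: N => [|N ih].
  by rewrite mul0n big_geq// big1// => r _; rewrite big_geq.
rewrite mulSnr nat_sumD ih -big_split/=; apply: eq_bigr => r _.
by rewrite big_nat_recr.
Qed.

(** For [N = Q b + s] the sum consists of [b] sums of length [Q] and fewer than [b] further terms.
    The approximate limit is the average of those of the classes. *)
Lemma mcauchy_residues (R : realType) (a : nat -> R[i]) b : (0 < b)%N ->
  (forall n, nrm (a n) <= 1) ->
  (forall r, (r < b)%N -> mcauchy (fun k => a (k * b + r)%N)) -> mcauchy a.
Proof.
move=> b0 a1 h e e0; have e2 : 0 < e / 2 by rewrite divr_gt0.
have b0' : 0 < b%:R :> R by rewrite ltr0n.
have /choice[l hl] : forall r, exists l, (r < b)%N -> \forall N \near \oo,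
    nrm (\sum_(0 <= k < N) a (k * b + r)%N - l *+ N) <= e / 2 * N%:R.
  move=> r; have [rb|_] := ltnP r b; last by exists 0.
  by have [l hl] := h r rb _ e2; exists l.
have hN := near_forall_lt hl.
have [N0 _ {}hN] := hN.
pose L := \sum_(0 <= r < b) l r.
exists (L / b%:R); near=> N.
have Nb : (N0 <= N %/ b)%N by rewrite leq_divRL//; near: N; exact: nbhs_infty_ge.
have {hN} hN := hN _ Nb.
set Q := (N %/ b)%N in hN; set s := (N %% b)%N.
have sb : (s < b)%N by rewrite ltn_mod.
have NE : N = (Q * b + s)%N by exact: divn_eq.
have -> : \sum_(0 <= n < N) a n - L / b%:R *+ N =
    \sum_(0 <= r < b) (\sum_(0 <= k < Q) a (k * b + r)%N - l r *+ Q) +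
    (\sum_(0 <= n < s) a (Q * b + n)%N - L / b%:R *+ s).
  rewrite NE nat_sumD nat_sumM sumrB sumrMnl -/L mulrnDr.
  rewrite [in L / _ *+ (Q * b)]mulnC mulrnA -[L / _ *+ b]mulr_natr divfK//; last first.
    by rewrite pnatr_eq0 -lt0n.
  by rewrite opprD addrACA.
apply: le_trans (nrmD _ _) _; rewrite [e in leRHS](splitr e) mulrDl.
apply: lerD.
  apply: le_trans (@nrm_nat_sum _ _ _ (e / 2 * Q%:R) _ _) _.
    by move=> r rb; exact: hN.
  rewrite -[leLHS]mulrA -natrM; apply: ler_wpM2l; first exact: ltW.
  by rewrite ler_nat leq_divM.
apply: (@le_trans _ _ (b%:R + nrm (L / b%:R) * b%:R)).
  apply: le_trans (nrmD _ _) _; rewrite nrmN nrmMn lerD//.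
    apply: le_trans (nrm_nat_sum (fun n _ => a1 _)) _.
    by rewrite mul1r ler_nat ltnW.
  by rewrite ler_wpM2l ?nrm_ge0// ler_nat ltnW.
rewrite -ler_pdivrMl//.
by near: N; exact: nbhs_infty_ger.
Unshelve. all: by end_near. Qed.

(** Since [(k b + r)^(d+1) - r^(d+1)] is a multiple of [b], the leading monomial is integer-valued
    on a residue class up to a constant, and the rest has lower degree. *)
Lemma residue_split (R : archiRealFieldType) (p : {poly R}) d b r :
  size p = d.+2 -> lead_coef p * b%:R \is a Num.int ->
  exists2 J : {poly R}, forall k : nat, J.[k%:R] \is a Num.int &
  exists2 p2 : {poly R}, (size p2 <= d.+1)%N &
  forall k, p.[(k * b + r)%N%:R] = J.[k%:R] + p2.[k%:R].
Proof.
move=> sp lb; pose u : {poly R} := b%:R *: 'X + r%:R%:P.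
have uE k : u.[k%:R] = (k * b + r)%N%:R.
  by rewrite /u !hornerE natrD natrM mulrC.
exists (lead_coef p *: (u ^+ d.+1 - (r%:R ^+ d.+1)%:P)).
  move=> k; rewrite hornerZ hornerD hornerN hornerC horner_exp uE subrXX.
  have -> : (k * b + r)%N%:R - r%:R = b%:R * k%:R :> R.
    by rewrite natrD addrK natrM mulrC.
  rewrite !mulrA -mulrA rpredM// rpredM ?natr_int// rpred_sum// => i _.
  by rewrite rpredM ?rpredX ?natr_int.
exists ((lead_coef p * r%:R ^+ d.+1)%:P + ((p - lead_coef p *: 'X^(d.+1)) \Po u)).
  apply: leq_trans (size_polyD _ _) _; rewrite geq_max.
  rewrite (leq_trans (size_polyC_leq1 _))//=.
  have su : (size u <= 2)%N.
    apply: leq_trans (size_polyD _ _) _; rewrite geq_max.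
    rewrite (leq_trans (size_scale_leq _ _)) ?size_polyX//.
    by rewrite (leq_trans (size_polyC_leq1 _)).
  apply: leq_trans (size_comp_poly_leq _ _) _; rewrite ltnS.
  apply: (@leq_trans (d * 1)); last by rewrite muln1.
  rewrite leq_mul//; last by case: (size u) su.
  have sq : (size (p - lead_coef p *: 'X^(d.+1))%R <= d.+1)%N.
    exact: size_sub_lead.
  by case: (size _) sq.
move=> k; rewrite hornerZ !hornerD !hornerN !hornerC horner_exp horner_comp uE.
by rewrite !hornerD hornerN hornerZ hornerXn; ring.
Qed.

Lemma e2piD_int (R : realType) (s t : R) : s \is a Num.int ->
  expi2pi (s + t) = expi2pi t.
Proof. by move=> si; rewrite e2piD e2pi_Num_int// mul1r. Qed.

Lemma mcauchy_cst (R : realType) (V : normedZmodType R[i]) (c : V) :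
  mcauchy (fun=> c).
Proof.
move=> e e0; exists c; near=> N.
by rewrite sumr_const_nat subn0 subrr nrm0 mulr_ge0// ltW.
Unshelve. all: by end_near. Qed.

Lemma mcauchy_weyl (R : realType) (p : {poly R}) :
  mcauchy (fun n => expi2pi p.[n%:R]).
Proof.
have [m] := ubnP (size p); elim: m p => // m ih p; rewrite ltnS => pm.
case sp : (size p) => [|[|d]].
- by apply: eq_mcauchy (@mcauchy_cst _ _ (expi2pi p`_0)) => n; rewrite size1_horner ?sp.
- by apply: eq_mcauchy (@mcauchy_cst _ _ (expi2pi p`_0)) => n; rewrite size1_horner ?sp.
have [[b b0 hb]|irr] := pselect (exists2 b, (0 < b)%N &
    lead_coef p * b%:R \is a Num.int); last first.
  apply: mnull_mcauchy; apply: (weyl_irrational sp) => b b0.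
  by apply/negP => h; apply: irr; exists b.
apply: (mcauchy_residues b0) => [n|r _]; first by rewrite nrm_e2pi.
have [J Ji [p2 sp2 p2E]] := residue_split r sp hb.
apply: eq_mcauchy (ih p2 _); last by rewrite (leq_ltn_trans sp2)// -sp.
by move=> k; rewrite p2E e2piD_int.
Qed.

(** The Fejer kernel as a square, with mean 1 over a period and value [L] at the integers when
    [L > 0]. *)
Definition fejer (R : realType) L (t : R) : R :=
  nrm (\sum_(0 <= l < L) expi2pi (l%:R * t)) ^+ 2 / L%:R.

Lemma fejer_ge0 (R : realType) L (t : R) : 0 <= fejer L t.
Proof. by rewrite divr_ge0// sqr_ge0. Qed.

Lemma fejer_int (R : realType) L (s t : R) : s \is a Num.int ->
  fejer L (s + t) = fejer L t.
Proof.
move=> si; rewrite /fejer; congr (nrm _ ^+ 2 / _); apply: eq_bigr => l _.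
by rewrite mulrDr e2piD_int// rpredM// natr_int.
Qed.

Lemma fejerE (R : realType) L (t : R) :
  (fejer L t)%:C%C = (L%:R^-1)%:C%C *
  \sum_(0 <= l < L) \sum_(0 <= k < L) expi2pi ((l%:R - k%:R) * t).
Proof.
rewrite /fejer mulrC rmorphM rmorphXn/= -nrmE normCK; congr (_ * _).
rewrite rmorph_sum/= mulr_suml; apply: eq_bigr => l _.
rewrite mulr_sumr; apply: eq_bigr => k _.
by rewrite -e2piN -e2piD mulrBl.
Qed.

Lemma sum_e2pi_orthogonal (R : realType) L k l : (k < L)%N -> (l < L)%N ->
  \sum_(0 <= i < L) expi2pi ((k%:R - l%:R) / L%:R * i%:R : R) =
  if k == l then L%:R else 0.
Proof.
move=> kL lL; have [->|kl] := eqVneq k l.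
  rewrite (eq_bigr (fun=> 1)); first by rewrite sumr_const_nat subn0.
  by move=> i _; rewrite subrr !mul0r e2pi0.
have L0 : L%:R != 0 :> R by rewrite pnatr_eq0 -lt0n (leq_ltn_trans _ lL).
rewrite big_mkord sum_e2pi_roots//; first by rewrite divfK// rpredB// natr_int.
apply/negP => /intrP[z hz].
have {}hz : (k%:Z - l%:Z)%:~R = (z * L%:Z)%:~R :> R.
  by rewrite intrB intrM -hz divfK.
move/intr_inj : hz => hz.
have : `|k%:Z - l%:Z|%N = (`|z| * L)%N by rewrite hz abszM.
have : (`|k%:Z - l%:Z| < L)%N by lia.
have : `|k%:Z - l%:Z|%N != 0%N by move/eqP: kl; lia.
by move=> h1 h2 h3; move: h1 h2; rewrite h3; case: `|z|%N => [|n]; lia.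
Qed.

(** The frequencies [l - k] of the kernel satisfy [|l - k| < L], and summing over the [L] translates
    kills all of them but 0. Divided by [L], the translates are an exact partition of unity. *)
Lemma sum_fejer (R : realType) L (t : R) : (0 < L)%N ->
  \sum_(0 <= i < L) fejer L (t - i%:R / L%:R) = L%:R.
Proof.
move=> L0; have L0' : L%:R != 0 :> R by rewrite pnatr_eq0 -lt0n.
apply: (@complexI R); rewrite rmorph_sum/=.
under eq_bigr do rewrite fejerE.
rewrite -mulr_sumr exchange_big/=.
rewrite big_nat (eq_bigr (fun l => L%:R)); last first.
  move=> l /andP[_ lL]; rewrite exchange_big/=.
  rewrite big_nat (eq_bigr (fun k => if k == l then L%:R else 0)).
    by rewrite -big_nat (nat_sum_delta (fun=> L%:R)).
  move=> k /andP[_ kL].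
  rewrite (eq_bigr (fun i => expi2pi ((l%:R - k%:R) * t) *
     expi2pi ((k%:R - l%:R) / L%:R * i%:R))); last first.
    by move=> i _; rewrite -e2piD; congr expi2pi; ring.
  rewrite -mulr_sumr sum_e2pi_orthogonal//.
  by case: eqP => [->|]; rewrite ?mulr0// subrr mul0r e2pi0 mul1r.
rewrite -big_nat sumr_const_nat subn0 -[X in _ * X]mulr_natr mulrA.
by rewrite -!(rmorph_nat (real_complex R)) -!rmorphM mulVf// mul1r.
Qed.

(** By the geometric sum the left-hand side is [nrm (expi2pi (s * L%:R) - 1) ^+ 2] for [L > 0]. *)
Lemma fejer_away (R : realType) L (s : R) :
  fejer L s * L%:R * nrm (expi2pi s - 1) ^+ 2 <= 4.
Proof.
have [->|L0] := posnP L; first by rewrite mulr0 mul0r.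
rewrite /fejer divfK ?pnatr_eq0 -?lt0n//.
rewrite big_mkord -exprMn -nrmM mulrC.
under eq_bigr do rewrite mulrC e2pi_nat.
rewrite -subrX1 -e2pi_nat.
have h : nrm (expi2pi (s * L%:R) - 1) <= 2.
  apply: le_trans (nrmD _ _) _; rewrite nrmN nrm_e2pi.
  by have -> : nrm (1 : R[i]) = 1 by rewrite -(e2pi0 R) nrm_e2pi.
have := nrm_ge0 (expi2pi (s * L%:R) - 1); nra.
Qed.

(** As [pi < 4], the constant 16 keeps every angle [2 pi l s] within [1/2] of 0, so that each term
    has real part at least [1/2]. *)
Lemma fejer_near0 (R : realType) L (s : R) :
  (0 < L)%N -> `|s| * (16 * L%:R) <= 1 -> L%:R <= 4 * fejer L s.
Proof.
move=> L0 hs; have L0' : 0 < L%:R :> R by rewrite ltr0n.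
have h : L%:R / 2 <= nrm (\sum_(0 <= l < L) expi2pi (l%:R * s)).
  apply: le_trans (Re_le_nrm _); rewrite raddf_sum/=.
  have -> : L%:R / 2 = \sum_(0 <= l < L) 2^-1 :> R.
    by rewrite sumr_const_nat subn0 mulr_natl.
  apply: ler_sum_nat => l /andP[_ lL].
  have := cos_lip (2 * pi * (l%:R * s)) 0; rewrite cos0 subr0.
  have p4 : pi < 4 :> R by have := pihalf_lt2 R; lra.
  have p0 := pi_gt0 R.
  have lL' : l%:R <= L%:R :> R by rewrite ler_nat ltnW.
  have l0 : 0 <= l%:R :> R by [].
  have s0 : 0 <= `|s| by [].
  have -> : `|2 * pi * (l%:R * s)| = 2 * pi * (l%:R * `|s|).
    rewrite !normrM (ger0_norm (pi_ge0 R)) (ger0_norm l0) ger0_norm//.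
  have h1 : l%:R * `|s| <= L%:R * `|s| by rewrite ler_wpM2r.
  have h2 : 2 * pi * (l%:R * `|s|) <= 8 * (L%:R * `|s|).
    have : 0 <= l%:R * `|s| by rewrite mulr_ge0.
    by nra.
  by rewrite ler_norml => /andP[]; lra.
rewrite /fejer mulrA ler_pdivlMr//.
have : (L%:R / 2) ^+ 2 <= nrm (\sum_(0 <= l < L) expi2pi (l%:R * s)) ^+ 2.
  by rewrite lerXn2r ?nnegrE ?nrm_ge0 ?divr_ge0.
by rewrite exprMn; lra.
Qed.

(** * Phases with integer parts *)

(** The kernel has mean 1 along a sequence equidistributed modulo 1; 2 is the slack of
    [sum_diagonal]. With [fejer_near0] this says that such a sequence is rarely close to an
    integer. *)
Lemma sum_fejer_mean (R : realType) (p : nat -> R) L : (0 < L)%N ->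
  (forall l, (0 < l)%N -> mnull setT (fun (_ : unit) n => expi2pi (l%:R * p n))) ->
  \forall N \near \oo, \sum_(0 <= n < N) fejer L (p n) <= 2 * N%:R.
Proof.
move=> L0 hp; have L0' : 0 < L%:R :> R by rewrite ltr0n.
have Li : 0 < L%:R^-1 :> R by rewrite invr_gt0.
have hW : \forall N \near \oo, forall l, (l < L)%N -> forall k, (k < L)%N ->
    nrm (\sum_(0 <= n < N) expi2pi ((l%:R - k%:R) * p n)) <=
    (l == k)%:R * N%:R + L%:R^-1 * N%:R.
  apply: near_forall_lt => l lL; apply: near_forall_lt => k kL.
  case: (ltngtP l k) => [lk|kl|<-].
  - have := hp (k - l)%N _ _ Li; rewrite subn_gt0 => /(_ lk).
    apply: filterS => N /(_ tt Logic.I); rewrite mul0r add0r; apply: le_trans.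
    rewrite -nrm_conj rmorph_sum/=.
    under eq_bigr do rewrite -e2piN -mulNr opprB -natrB ?(ltnW lk)//.
    exact: lexx.
  - have := hp (l - k)%N _ _ Li; rewrite subn_gt0 => /(_ kl).
    apply: filterS => N /(_ tt Logic.I); rewrite mul0r add0r; apply: le_trans.
    by rewrite natrB ?(ltnW kl).
  - near=> N; rewrite mul1r.
    rewrite -[leLHS]addr0 lerD ?mulr_ge0 ?(ltW Li)//.
    rewrite -[leRHS]mul1r; apply: nrm_nat_sum => n _.
    by rewrite nrm_e2pi.
near=> N.
have -> : \sum_(0 <= n < N) fejer L (p n) =
    nrm (\sum_(0 <= n < N) (fejer L (p n))%:C%C : R[i]).
  rewrite -rmorph_sum nrm_real ger0_norm// sumr_ge0// => n _.
  exact: fejer_ge0.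
under eq_bigr do rewrite fejerE.
rewrite -mulr_sumr nrmM nrm_real (ger0_norm (ltW Li)) ler_pdivrMl//.
rewrite exchange_big/=; apply: le_trans (nrm_sum _ _ _) _.
rewrite [leRHS](_ : _ = 2 * (L%:R * N%:R)); last by ring.
rewrite -sum_diagonal//; apply: ler_sum_nat => l /andP[_ lL].
rewrite exchange_big/=; apply: le_trans (nrm_sum _ _ _) _.
apply: ler_sum_nat => k /andP[_ kL].
by move: l lL k kL; near: N.
Unshelve. all: by end_near. Qed.

(* A discretised Fejer mean: a trigonometric polynomial in [t] close to
   [e(- th * frac t)], whose jump at the integers precludes uniform approximation. *)
Definition fejer_mean (R : realType) (th : R) L (t : R) : R[i] :=
  (L%:R^-1)%:C%C * \sum_(0 <= i < L)
    expi2pi (- (th * (i%:R / L%:R))) * (fejer L (t - i%:R / L%:R))%:C%C.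

(** The three errors: sample points within [h] of [t], by Lipschitz continuity; sample points
    farther away, where the kernel is small; and [t] itself within [h] of the jump. There only the
    trivial bound 2 holds, and [h] is the radius of [fejer_near0], which makes the last term at
    least 2. *)
Lemma fejer_mean_approx (R : realType) (th : R) M (h := (16 * M%:R)^-1)
    L (t : R) : (0 < M)%N -> (0 < L)%N -> 0 <= t < 1 ->
  nrm (expi2pi (- (th * t)) - fejer_mean th L t) <=
  4 * pi * `|th| * h + 8 / (L%:R * (2 - 2 * cos (2 * pi * h))) +
  8 / M%:R * fejer M t.
Proof.
move=> M0 L0 /andP[t0 t1].
have L0' : 0 < L%:R :> R by rewrite ltr0n.
have M1 : 1 <= M%:R :> R by rewrite ler1n.
have h0 : 0 < h by rewrite invr_gt0; lra.
have hM : h * (16 * M%:R) = 1 by rewrite mulVf// gt_eqF//; lra.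
have h1 : h <= 2^-1 by nra.
clearbody h.
have k0 : 0 < 2 - 2 * cos (2 * pi * h).
  by have := @cos_lt1 R h; rewrite h0 h1 => /(_ isT); lra.
have nb s : nrm (expi2pi (- (th * t)) - expi2pi s) <= 2.
  by apply: le_trans (nrmD _ _) _; rewrite nrmN !nrm_e2pi.
have hsum : \sum_(0 <= i < L) fejer L (t - i%:R / L%:R) = L%:R.
  exact: sum_fejer.
have A0 : 0 <= 4 * pi * `|th| * h.
  by rewrite !mulr_ge0 ?pi_ge0// ltW.
have B0 : 0 <= 8 / (L%:R * (2 - 2 * cos (2 * pi * h))).
  by rewrite divr_ge0// mulr_ge0// ltW.
rewrite [X in nrm X](_ : _ = (L%:R^-1)%:C%C * \sum_(0 <= i < L)
    (expi2pi (- (th * t)) - expi2pi (- (th * (i%:R / L%:R)))) *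
    (fejer L (t - i%:R / L%:R))%:C%C); last first.
  rewrite /fejer_mean; under [in RHS]eq_bigr do rewrite mulrBl.
  rewrite sumrB mulrBr; congr (_ - _).
  rewrite -mulr_sumr -rmorph_sum hsum mulrCA -rmorphM mulVf ?gt_eqF//.
  by rewrite rmorph1 mulr1.
rewrite nrmM nrm_real ger0_norm ?invr_ge0// ler_pdivrMl//.
apply: le_trans (nrm_sum _ _ _) _.
rewrite (eq_bigr (fun i => nrm (expi2pi (- (th * t)) -
   expi2pi (- (th * (i%:R / L%:R)))) * fejer L (t - i%:R / L%:R))); last first.
  by move=> i _; rewrite nrmM nrm_real ger0_norm// fejer_ge0.
have [tin|tout] := boolP (h <= t <= 1 - h).
  apply: (@le_trans _ _ (\sum_(0 <= i < L)
    (4 * pi * `|th| * h * fejer L (t - i%:R / L%:R) +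
     8 / (L%:R * (2 - 2 * cos (2 * pi * h)))))); last first.
    rewrite big_split/= -mulr_sumr hsum sumr_const_nat subn0 -[_ *+ L]mulr_natr.
    have F0 := fejer_ge0 M t.
    have : 0 <= 8 / M%:R * fejer M t by rewrite mulr_ge0// divr_ge0.
    by nra.
  apply: ler_sum_nat => i /andP[_ iL].
  set s := t - i%:R / L%:R.
  have F0 := fejer_ge0 L s.
  have iL0 : 0 <= i%:R / L%:R :> R by rewrite divr_ge0.
  have iL1 : i%:R / L%:R < 1 :> R by rewrite ltr_pdivrMr// mul1r ltr_nat.
  have [sh|hs] := ltP `|s| h.
    have : nrm (expi2pi (- (th * t)) - expi2pi (- (th * (i%:R / L%:R)))) <=
        4 * pi * `|th| * h.
      apply: le_trans (e2pi_lip _ _) _.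
      rewrite opprK addrC -mulrBr normrM distrC mulrA.
      by rewrite ler_wpM2l ?(ltW sh)// !mulr_ge0 ?pi_ge0.
    by move=> /(ler_wpM2r F0); lra.
  (* As [t] is in [[h, 1 - h]], no sample point is close to [t] modulo 1 across the jump. *)
  have s1 : `|s| <= 1 - h by move: tin; rewrite ler_norml /s => /andP[? ?]; lra.
  have cs : cos (2 * pi * s) <= cos (2 * pi * h).
    by apply: cos_le_away; [rewrite (ltW h0)|rewrite hs].
  have Fb : fejer L s <= 4 / (L%:R * (2 - 2 * cos (2 * pi * h))).
    rewrite ler_pdivlMr ?mulr_gt0// mulrA.
    apply: le_trans (fejer_away L s); rewrite nrm_e2piB1.
    by apply: ler_wpM2l; [rewrite mulr_ge0|lra].
  have := ler_pM (nrm_ge0 _) F0 (nb (- (th * (i%:R / L%:R)))) Fb.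
  have : 0 <= 4 * pi * `|th| * h * fejer L s by rewrite mulr_ge0.
  have -> : 8 / (L%:R * (2 - 2 * cos (2 * pi * h))) =
    2 * (4 / (L%:R * (2 - 2 * cos (2 * pi * h)))) by rewrite mulrA -natrM.
  by lra.
apply: (@le_trans _ _ (2 * L%:R)).
  rewrite -[X in _ <= 2 * X]hsum mulr_sumr; apply: ler_sum => i _.
  by rewrite ler_wpM2r ?fejer_ge0.
have Fb : 2 <= 8 / M%:R * fejer M t.
  rewrite mulrAC ler_pdivlMr; last by lra.
  suff : M%:R <= 4 * fejer M t by lra.
  move: tout; rewrite negb_and -!ltNge => /orP[th'|th'].
    by apply: fejer_near0 => //; rewrite ger0_norm//; nra.
  rewrite -(@fejer_int _ _ (-1)) ?rpredN ?rpred1//.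
  by apply: fejer_near0 => //; rewrite ler0_norm; nra.
by rewrite mulrC; apply: ler_wpM2l => //; lra.
Qed.

Lemma fejer_mean_int (R : realType) (th : R) L (m t : R) :
  m \is a Num.int -> fejer_mean th L (m + t) = fejer_mean th L t.
Proof.
move=> mi; rewrite /fejer_mean; congr (_ * _); apply: eq_bigr => i _.
by rewrite -[m + t - _]addrA (fejer_int _ _ mi).
Qed.

(** Once the kernel is expanded, this is a finite combination of exponentials of real polynomials,
    to which Weyl's theorem applies. *)
Lemma mcauchy_fejer_mean (R : realType) (th : R) L (p q : {poly R}) :
  mcauchy (fun n => expi2pi q.[n%:R] * fejer_mean th L p.[n%:R]).
Proof.
pose f i l k n := (L%:R^-1)%:C%C * expi2pi (- (th * (i%:R / L%:R))) *
  (L%:R^-1)%:C%C * expi2pi (q + (l%:R - k%:R) *: (p - (i%:R / L%:R)%:P)).[n%:R].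
apply: (@eq_mcauchy _ _ (fun n => \sum_(0 <= i < L) \sum_(0 <= l < L)
    \sum_(0 <= k < L) f i l k n)); last first.
  by do 3![apply: mcauchy_sum => ?]; exact/mcauchyZ/mcauchy_weyl.
move=> n; rewrite /fejer_mean mulrA mulr_sumr; apply: eq_bigr => i _.
rewrite fejerE !mulrA mulr_sumr; apply: eq_bigr => l _.
rewrite mulr_sumr; apply: eq_bigr => k _; rewrite /f.
by rewrite hornerD hornerZ hornerD hornerN hornerC e2piD -(mulrA th); ring.
Qed.

(** With [u] the fractional part of [p(n)], [th * [p(n)] = th * p(n) - th * u]. The first term joins
    [q]; the phase of the second is replaced by a Fejer mean, which is accurate except for the few
    [n] with [p(n)] near an integer. *)
Lemma mcauchy_bracket_equidistributed (R : realType) (th : R) (p q : {poly R}) :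
  (forall l, (0 < l)%N ->
    mnull setT (fun (_ : unit) n => expi2pi (l%:R * p.[n%:R]))) ->
  mcauchy (fun n => expi2pi (q.[n%:R] + th * (Num.floor p.[n%:R])%:~R)).
Proof.
move=> hp; apply: mcauchy_approx => e e0.
have c0 : 0 <= 4 * pi * `|th| by rewrite !mulr_ge0 ?pi_ge0.
(* [M] bounds the first and third errors together by [e / 2]: [h <= 1 / M], and 16 is 8 times the
   bound 2 of [sum_fejer_mean]. *)
pose M := (Num.truncn ((4 * pi * `|th| + 16) / (e / 2))).+1.
have M0 : 0 < M%:R :> R by rewrite ltr0n.
have hM : 4 * pi * `|th| + 16 <= e / 2 * M%:R.
  by rewrite [leRHS]mulrC -ler_pdivrMr ?divr_gt0//; exact/ltW/truncnS_gt.
pose h : R := (16 * M%:R)^-1.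
have h0 : 0 < h by rewrite invr_gt0; lra.
have hM1 : h * (16 * M%:R) = 1 by rewrite mulVf// gt_eqF//; lra.
have M1 : 1 <= M%:R :> R by rewrite ler1n.
have h1 : h <= 2^-1 by nra.
have k0 : 0 < 2 - 2 * cos (2 * pi * h).
  by have := @cos_lt1 R h; rewrite h0 h1 => /(_ isT); lra.
(* [L] is chosen after [M], because the size of the kernel away from 0 is controlled through [h]. *)
pose L := (Num.truncn (8 / (e / 2 * (2 - 2 * cos (2 * pi * h))))).+1.
have L0 : 0 < L%:R :> R by rewrite ltr0n.
have hL : 8 / (L%:R * (2 - 2 * cos (2 * pi * h))) <= e / 2.
  rewrite ler_pdivrMr ?mulr_gt0// mulrCA -ler_pdivrMr ?mulr_gt0 ?divr_gt0//.
  exact/ltW/truncnS_gt.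
exists (fun n => expi2pi (q + th *: p).[n%:R] * fejer_mean th L p.[n%:R]).
  exact: mcauchy_fejer_mean.
have hF := @sum_fejer_mean _ (fun n => p.[n%:R]) M isT hp.
near=> N; apply: le_trans (nrm_sum _ _ _) _.
apply: (@le_trans _ _ (\sum_(0 <= n < N) (4 * pi * `|th| * h +
    8 / (L%:R * (2 - 2 * cos (2 * pi * h))) + 8 / M%:R * fejer M p.[n%:R]))).
  apply: ler_sum => n _; set t := p.[n%:R].
  set m := Num.floor t; pose u := t - m%:~R.
  have tE : t = m%:~R + u by rewrite addrC subrK.
  have u01 : 0 <= u < 1.
    by have := floor_itv t; rewrite intrD /u => /andP[? ?]; apply/andP; split; lra.
  rewrite tE fejer_mean_int ?intr_int// fejer_int ?intr_int//.
  have := @fejer_mean_approx R th M L u isT isT u01; apply: le_trans.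
  rewrite hornerD hornerZ -/t.
  have -> : q.[n%:R] + th * m%:~R = q.[n%:R] + th * t + - (th * u).
    by rewrite /u; ring.
  by rewrite e2piD -mulrBr nrmM nrm_e2pi mul1r.
rewrite big_split/= sumr_const_nat subn0 -[_ *+ N]mulr_natr -mulr_sumr.
have : \sum_(0 <= n < N) fejer M p.[n%:R] <= 2 * N%:R by near: N.
set S := \sum_(_ <= _ < _) _ => hS.
have S2 : 8 / M%:R * S <= 16 / M%:R * N%:R.
  have : 8 / M%:R * S <= 8 / M%:R * (2 * N%:R).
    by apply: ler_wpM2l hS; rewrite divr_ge0.
  by move=> /le_trans; apply; rewrite le_eqVlt; apply/orP; left; apply/eqP; ring.
have hh : 4 * pi * `|th| * h + 16 / M%:R <= e / 2.
  have : (4 * pi * `|th| + 16) / M%:R <= e / 2 by rewrite ler_pdivrMr.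
  have : 4 * pi * `|th| * h <= 4 * pi * `|th| / M%:R.
    by apply: ler_wpM2l => //; rewrite lef_pV2 ?posrE//; lra.
  by rewrite mulrDl; lra.
have N0 : 0 <= N%:R :> R by [].
have := ler_wpM2r N0 hh; have := ler_wpM2r N0 hL; rewrite !mulrDl; lra.
Unshelve. all: by end_near. Qed.

(* A rational leading coefficient is removed by passing to residue classes,
   where it contributes an integer to [p] and hence only a phase; with an
   irrational one, [p] is equidistributed modulo 1. *)
Lemma mcauchy_bracket (R : realType) (th : R) (p q : {poly R}) :
  mcauchy (fun n => expi2pi (q.[n%:R] + th * (Num.floor p.[n%:R])%:~R)).
Proof.
have [m] := ubnP (size p); elim: m p q => // m ih p q; rewrite ltnS => pm.
have [sp|] := leqP (size p) 1.
  apply: eq_mcauchy (@mcauchy_weyl _ (q + (th * (Num.floor p`_0)%:~R)%:P)) => n.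
  by rewrite hornerD hornerC (size1_horner _ sp).
case sp : (size p) => [|[|d]]// _.
have [[b b0 hb]|irr] := pselect (exists2 b, (0 < b)%N &
    lead_coef p * b%:R \is a Num.int); last first.
  apply: mcauchy_bracket_equidistributed => l l0.
  have l0' : l%:R != 0 :> R by rewrite pnatr_eq0 -lt0n.
  have h : mnull setT (fun (_ : unit) n => expi2pi (l%:R *: p).[n%:R]).
    apply: (@weyl_irrational R d); first by rewrite size_scale.
    move=> c c0; apply/negP => hc; apply: irr.
    exists (l * c)%N; first by rewrite muln_gt0 l0.
    by rewrite natrM mulrCA mulrA -lead_coefZ.
  by apply: eq_mnull h => _ n; rewrite hornerZ.
apply: (mcauchy_residues b0) => [n|r _]; first by rewrite nrm_e2pi.
have [J Ji [p2 sp2 p2E]] := residue_split r sp hb.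
pose u : {poly R} := b%:R *: 'X + r%:R%:P.
apply: eq_mcauchy (ih p2 ((q \Po u) + th *: J) _).
  move=> k; rewrite p2E floorDzr// intrD (floorK (Ji k)) hornerD horner_comp.
  rewrite hornerZ /u hornerD hornerC hornerZ hornerX natrD natrM.
  by congr expi2pi; rewrite (mulrC b%:R); ring.
by rewrite (leq_ltn_trans sp2)// -sp.
Qed.

(** * The mean ergodic theorem *)

Lemma real_inf_approx (R : realType) (I : set R) : I !=set0 ->
  (forall t, I t -> 0 <= t) ->
  exists d, (forall t, I t -> d <= t) /\
    (forall e, 0 < e -> exists2 t, I t & t < d + e).
Proof.
move=> I0 Ige0; have hI : has_inf I by split => //; exists 0 => t /Ige0.
exists (inf I); split=> [t It|e e0]; first by apply: ge_inf It; case: hI.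
exact: inf_adherent.
Qed.

Lemma nrm_complete (R : realType) (H : completeNormedModType R[i]) (u : nat -> H) :
  (forall e : R, 0 < e -> exists n, forall m, (n <= m)%N -> nrm (u m - u n) <= e) ->
  exists l, forall e : R, 0 < e -> \forall n \near \oo, nrm (u n - l) <= e.
Proof.
move=> hu; have cu : cvg (u n @[n --> \oo]).
  apply/cauchy_cvgP; apply: cauchy_exP => e e0.
  have eE : e = (complex.Re e)%:C%C by rewrite RRe_real ?gtr0_real.
  have e0' : 0 < complex.Re e / 2 by rewrite divr_gt0//; move: e0; rewrite ltcE => /andP[].
  have [n hn] := hu _ e0'; exists (u n); exists n => // m /= nm.
  rewrite -ball_normE/= nrmE eE ltcR nrmB; apply: le_lt_trans (hn m nm) _.
  by move: e0'; lra.
exists (lim (u n @[n --> \oo])) => e e0.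
have e0' : 0 < e%:C%C by rewrite ltcR.
move/cvgrPdist_le : cu => /(_ _ e0'); apply: filterS => n.
by rewrite nrmE lecR nrmB.
Qed.

(** Cantor's intersection argument for the sets [P d], used for both minimisations. The sets need
    not be closed, so the limit is only approached by their elements. *)
Lemma nested_limit (R : realType) (H : completeNormedModType R[i])
    (P : R -> H -> Prop) :
  (forall d d' v, d <= d' -> P d v -> P d' v) ->
  (forall d, 0 < d -> exists v, P d v) ->
  (forall e, 0 < e -> exists2 d, 0 < d &
    forall v w, P d v -> P d w -> nrm (v - w) <= e) ->
  exists u, forall e d : R, 0 < e -> 0 < d -> exists2 v, P d v & nrm (u - v) <= e.
Proof.
move=> Pmono Pex Pdiam.
have i0 n : 0 < n.+1%:R^-1 :> R by rewrite invr_gt0.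
have small e : 0 < e -> exists N, forall n, (N <= n)%N -> n.+1%:R^-1 <= e :> R.
  move=> e0; have [N _ hN] := nbhs_infty_ger (e^-1 : R); exists N => n Nn.
  rewrite -[leRHS]invrK lef_pV2 ?posrE ?invr_gt0//.
  by apply: hN => /=; exact: leq_trans Nn _.
have /choice[u hu] : forall n, exists v, P n.+1%:R^-1 v by move=> n; exact: Pex.
have [l hl] : exists l, forall e : R, 0 < e -> \forall n \near \oo, nrm (u n - l) <= e.
  apply: nrm_complete => e /Pdiam[d d0 hd].
  have [N hN] := small _ d0; exists N => m Nm.
  by apply: hd; apply: Pmono (hu _); exact: hN.
exists l => e d e0 d0; have [N hN] := small _ d0.
have [N' _ hN'] := hl _ e0; exists (u (maxn N N')).
  by apply: Pmono (hu _); apply: hN; rewrite leq_maxl.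
by rewrite nrmB; apply: hN' => /=; rewrite leq_maxr.
Qed.

Section linear_iter.
Context (R : pzRingType) (H : lmodType R) (T : {linear H -> H}).

Lemma iter_is_linear n : linear (iter n T).
Proof.
elim: n => // n ih a x y.
change (T (iter n T (a *: x + y)) = a *: T (iter n T x) + T (iter n T y)).
have -> : iter n T (a *: x + y) = a *: iter n T x + iter n T y by exact: ih.
exact: linearP.
Qed.

HB.instance Definition _ n := GRing.isLinear.Build R H H _ (iter n T)
  (iter_is_linear n).

End linear_iter.

Lemma iter_scale (R : comPzRingType) (H : lmodType R) (T : {linear H -> H}) a n x :
  iter n (a \*: T) x = a ^+ n *: iter n T x.
Proof.
elim: n => [|n ih]; first by rewrite expr0 scale1r.
by rewrite iterS ih /= linearZ/= scalerA exprS.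
Qed.

Definition mean_null (R : realType) (H : normedModType R[i])
    (S : {linear H -> H}) (v : H) :=
  mnull setT (fun (_ : unit) n => iter n S v).

Section mean_ergodic.
Context (R : realType) (H : completeNormedModType R[i]).
Context (dot : {dot H for @Num.conj R[i]}) (hdot : induces_norm dot).
Context (S : {linear H -> H}) (M : R).
Context (hS : forall n x, nrm (iter n S x) <= M * nrm x).

Lemma mean_nullD v w : mean_null S v -> mean_null S w -> mean_null S (v + w).
Proof.
move=> hv hw e e0; have e2 : 0 < e / 2 by rewrite divr_gt0.
have {}hv := hv _ e2; have {}hw := hw _ e2; near=> N => c Dc.
under eq_bigr do rewrite linearD; rewrite big_split/=.
apply: le_trans (nrmD _ _) _; rewrite [e in leRHS](splitr e) mulrDl.
by apply: lerD; move: c Dc; near: N.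
Unshelve. all: by end_near. Qed.

Lemma mean_nullZ a v : mean_null S v -> mean_null S (a *: v).
Proof.
move=> hv e e0; have a0 : 0 < nrm a + 1 by rewrite ltr_wpDl ?nrm_ge0.
have {}hv := hv (e / (nrm a + 1)) ltac:(by rewrite divr_gt0).
near=> N => c Dc.
under eq_bigr do rewrite linearZ/=.
rewrite -scaler_sumr nrmZ.
have : nrm (\sum_(0 <= n < N) iter n S v) <= e / (nrm a + 1) * N%:R.
  by move: c Dc; near: N.
rewrite mulrAC ler_pdivlMr//; apply: le_trans.
by rewrite mulrC ler_wpM2l ?nrm_ge0// lerDl.
Unshelve. all: by end_near. Qed.

Lemma mean_null_closed v :
  (forall e : R, 0 < e -> exists2 w, mean_null S w & nrm (v - w) <= e) ->
  mean_null S v.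
Proof.
move=> hv e e0; have M0 : 0 < `|M| + 1 by rewrite ltr_wpDl.
have e2 : 0 < e / 2 by rewrite divr_gt0.
have [w hw vw] := hv (e / 2 / (`|M| + 1)) ltac:(by rewrite divr_gt0).
have {}hw := hw _ e2; near=> N => c Dc.
rewrite -[v in leLHS](subrK w).
under eq_bigr do rewrite linearD; rewrite big_split/=.
apply: le_trans (nrmD _ _) _; rewrite [e in leRHS](splitr e) mulrDl.
apply: lerD; last by move: c Dc; near: N.
apply: nrm_nat_sum => n _; apply: le_trans (hS _ _) _.
rewrite ler_pdivlMr// in vw; apply: le_trans vw.
by rewrite mulrC ler_wpM2l ?nrm_ge0// (le_trans (ler_norm M))// lerDl.
Unshelve. all: by end_near. Qed.

Lemma mean_null_coboundary x i : mean_null S (x - iter i S x).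
Proof.
move=> e e0; near=> N => _ _.
under eq_bigr do rewrite linearB/= -iterD.
rewrite sumrB.
have -> : \sum_(0 <= n < N) iter n S x - \sum_(0 <= n < N) iter (n + i) S x =
    \sum_(0 <= n < i) iter n S x - \sum_(0 <= n < i) iter (N + n) S x.
  exact: (nat_sum_shift (fun n => iter n S x)).
apply: (@le_trans _ _ (2 * (M * nrm x * i%:R))); last first.
  rewrite -ler_pdivrMl//; near: N; exact: nbhs_infty_ger.
apply: le_trans (nrmD _ _) _; rewrite nrmN mulr_natl mulr2n.
by apply: lerD; apply: nrm_nat_sum.
Unshelve. all: by end_near. Qed.

Definition birkhoff N x : H := N%:R^-1 *: \sum_(0 <= i < N) iter i S x.

Lemma nrm_natV N : nrm (N%:R^-1 : R[i]) = N%:R^-1.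
Proof.
by rewrite -(rmorph_nat (real_complex R)) -fmorphV nrm_real ger0_norm.
Qed.

Lemma birkhoff_coboundary N x : (0 < N)%N -> mean_null S (x - birkhoff N x).
Proof.
move=> N0; have N0' : N%:R != 0 :> R[i] by rewrite pnatr_eq0 -lt0n.
have -> : x - birkhoff N x = N%:R^-1 *: \sum_(0 <= i < N) (x - iter i S x).
  rewrite sumrB sumr_const_nat subn0 scalerBr -[x *+ N](scaler_nat N x).
  by rewrite scalerA mulVf// scale1r.
apply: mean_nullZ; elim: (N) => [|n ih].
  by rewrite big_geq// -(subrr (0 : H)); exact: (mean_null_coboundary 0 0).
by rewrite big_nat_recr//=; apply: mean_nullD => //; exact: mean_null_coboundary.
Qed.

Lemma nrm_birkhoff N x : nrm (birkhoff N x) <= M * nrm x.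
Proof.
have [->|N0] := posnP N.
  by rewrite /birkhoff big_geq// scaler0 nrm0 (le_trans (nrm_ge0 _) (hS 0 x)).
rewrite nrmZ nrm_natV ler_pdivrMl ?ltr0n// mulrC.
exact: nrm_nat_sum.
Qed.

Lemma birkhoff_invariant N x :
  nrm (S (birkhoff N x) - birkhoff N x) <= N%:R^-1 * ((M + 1) * nrm x).
Proof.
rewrite /birkhoff linearZ/= -scalerBr nrmZ nrm_natV ler_wpM2l ?invr_ge0//.
rewrite linear_sum/= -sumrB telescope_sumr// mulrDl mul1r.
by apply: le_trans (nrmD _ _) _; rewrite nrmN lerD.
Qed.

(* Riesz's minimal norm argument, with approximate fixed points in place of the
   orbit's convex hull, since [S] need not be a contraction. *)
Lemma mean_ergodic x : exists2 v, S v = v & mean_null S (x - v).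
Proof.
(* [v] differs from [x] by a null vector, is fixed up to [d], and has squared norm at most [t]. The
   infimum below is over those [t] that stay attainable however small the defect. *)
pose Q t d v := [/\ mean_null S (x - v), nrm (S v - v) <= d & nrm v ^+ 2 <= t].
have [d [d_lb d_inf]] : exists d,
    (forall t, (forall e, 0 < e -> exists v, Q t e v) -> d <= t) /\
    (forall e, 0 < e -> exists2 t, (forall e, 0 < e -> exists v, Q t e v) & t < d + e).
  apply: real_inf_approx; last first.
    move=> t ht; have [v [_ _ vt]] := ht 1 ltr01.
    by apply: le_trans vt; exact: sqr_ge0.
  exists ((M * nrm x) ^+ 2) => e e0.
  pose N := (Num.truncn (((M + 1) * nrm x) / e)).+1.
  have N0 : 0 < N%:R :> R by rewrite ltr0n.
  exists (birkhoff N x); split; first exact: birkhoff_coboundary.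
    apply: le_trans (birkhoff_invariant _ _) _.
    rewrite ler_pdivrMl// -ler_pdivrMr//; exact/ltW/truncnS_gt.
  by rewrite lerXn2r ?nnegrE ?nrm_ge0 ?nrm_birkhoff// (le_trans (nrm_ge0 _) (hS 0 x)).
have [u hu] : exists u, forall e d' : R, 0 < e -> 0 < d' ->
    exists2 v, Q (d + d') d' v & nrm (u - v) <= e.
  apply: nested_limit => [d1 d2 v d12 [h1 h2 h3]|d1 d1_gt0|e e0].
  - by split => //; [exact: le_trans d12|apply: le_trans h3 _; rewrite lerD2l].
  - have [t ht td] := d_inf _ d1_gt0; have [v [h1 h2 h3]] := ht _ d1_gt0.
    by exists v; split => //; apply: le_trans h3 (ltW td).
  (* The midpoint has squared norm above [d - e ^+ 2 / 8], so the parallelogram law leaves at most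
     [4 * d2 + e ^+ 2 / 2 <= e ^+ 2] for [nrm (v - w) ^+ 2]. *)
  have e8 : 0 < e ^+ 2 / 8 by rewrite divr_gt0 ?exprn_gt0.
  have [d1 d1_gt0 hd1] : exists2 d1, 0 < d1 & forall v, Q (d - e ^+ 2 / 8) d1 v -> False.
    apply: contrapT => /forall2NP h.
    have : d <= d - e ^+ 2 / 8.
      apply: d_lb => d1 d1_gt0; apply: contrapT => h'.
      by case: (h d1) => // -[] v Qv; apply: h'; exists v.
    by lra.
  pose d2 := Num.min d1 (e ^+ 2 / 8).
  exists d2; first by rewrite lt_min d1_gt0.
  move=> v w [v1 v2 v3] [w1 w2 w3].
  have d2d1 : d2 <= d1 by rewrite ge_min lexx.
  have d2e : d2 <= e ^+ 2 / 8 by rewrite ge_min lexx orbT.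
  have nrm2V : nrm (2^-1 : R[i]) = 2^-1 by exact: nrm_natV 2.
  have half (z : H) : z = 2^-1 *: z + 2^-1 *: z.
    by rewrite -scalerDl -[X in X + X]mul1r -splitr scale1r.
  pose m := 2^-1 *: (v + w).
  have : ~ (nrm m ^+ 2 <= d - e ^+ 2 / 8).
    move=> hm; apply: (hd1 m); split => //.
      rewrite (_ : x - m = 2^-1 *: (x - v) + 2^-1 *: (x - w)).
        by apply: mean_nullD; exact: mean_nullZ.
      by rewrite [in LHS](half x) /m -scalerDr -scalerBr -scalerDr; congr (_ *: _);
        rewrite addrACA opprD.
    rewrite (_ : S m - m = 2^-1 *: ((S v - v) + (S w - w))); last first.
      by rewrite /m linearZ/= -scalerBr (linearD S) opprD addrACA.
    rewrite nrmZ nrm2V; have := nrmD (S v - v) (S w - w).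
    by move: v2 w2; lra.
  move=> /negP; rewrite -ltNge /m nrmZ nrm2V exprMn => hm.
  rewrite -(@ler_pXn2r _ 2)// ?nnegrE ?nrm_ge0//; last exact: ltW.
  have := parallelogram hdot v w.
  by move: v3 w3 hm; lra.
have M0 : 0 <= M * nrm (0 : H) by exact: le_trans (nrm_ge0 _) (hS 0 0).
exists u; last first.
  apply: mean_null_closed => e e0.
  have [v [v1 _ _] uv] := hu e 1 e0 ltr01.
  exists (x - v) => //.
  by rewrite opprB addrC addrA subrK nrmB.
apply/eqP; rewrite -subr_eq0 -nrm_eq0 eq_le nrm_ge0 andbT.
apply/ler_addgt0Pr => e e0; rewrite add0r.
pose c := `|M| + 2; have c0 : 0 < c by rewrite /c ltr_wpDl.
have [v [_ v2 _] uv] := hu (e / c / 2) (e / 2)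
  ltac:(by rewrite !divr_gt0) ltac:(by rewrite divr_gt0).
have -> : S u - u = S (u - v) + ((S v - v) + (v - u)).
  by rewrite linearB/= !addrA !subrK.
apply: le_trans (nrmD _ _) _; apply: le_trans (lerD (hS 1 _) (nrmD _ _)) _.
rewrite (nrmB v u).
have h1 : nrm (u - v) * c <= e / 2 by rewrite -ler_pdivlMr// mulrAC.
have := ler_wpM2r (nrm_ge0 (u - v)) (ler_norm M).
have := nrm_ge0 (u - v); move: h1 v2; rewrite /c; lra.
Qed.

End mean_ergodic.

(** * Eigenvectors and the complementary part *)

Lemma nrm1 (R : realType) : nrm (1 : R[i]) = 1.
Proof. by rewrite -(e2pi0 R) nrm_e2pi. Qed.

Lemma e2pi_mulrn_near1 (R : realType) (t : R) n :
  nrm (expi2pi (n%:R * t) - 1) <= n%:R * nrm (expi2pi t - 1).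
Proof.
elim: n => [|n ih]; first by rewrite mul0r e2pi0 subrr nrm0 mul0r.
rewrite -natr1 !mulrDl !mul1r e2piD.
have -> : expi2pi (n%:R * t) * expi2pi t - 1 =
    (expi2pi (n%:R * t) - 1) * expi2pi t + (expi2pi t - 1) by ring.
by apply: le_trans (nrmD _ _) _; rewrite nrmM nrm_e2pi mulr1 lerD2r.
Qed.

(** Pigeonhole: two of the [Q + 1] fractional parts of [j * t], [0 <= j <= Q], lie in the same one
    of [Q] intervals of length [1 / Q]. *)
Lemma dirichlet (R : realType) (t : R) Q : (0 < Q)%N ->
  exists2 j, (0 < j <= Q)%N & nrm (expi2pi (j%:R * t) - 1) <= 4 * pi / Q%:R.
Proof.
move=> Q0; have Q0' : 0 < Q%:R :> R by rewrite ltr0n.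
pose fr j : R := j%:R * t - (Num.floor (j%:R * t))%:~R.
have fr01 j : 0 <= fr j < 1.
  have := floor_itv (j%:R * t); rewrite intrD /fr => /andP[? ?].
  by apply/andP; split; lra.
have fQ j : (Num.truncn (Q%:R * fr j) < Q)%N.
  have /andP[f0 f1] := fr01 j.
  have /andP[h _] := truncn_itv (mulr_ge0 (ltW Q0') f0).
  rewrite -(ltr_nat R); apply: le_lt_trans h _.
  by rewrite -[ltRHS]mulr1 ltr_pM2l.
pose F (j : 'I_Q.+1) : 'I_Q := Ordinal (fQ j).
have : ~~ injectiveb F.
  by apply/negP => /injectiveP /leq_card; rewrite !card_ord ltnn.
move=> /injectivePn[j [k jk Fjk]].
have {Fjk}fjk : Num.truncn (Q%:R * fr j) = Num.truncn (Q%:R * fr k).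
  by case: Fjk.
wlog kj : j k jk fjk / (k < j)%N.
  move=> h; have [kj|jk'|/val_inj jk'] := ltngtP k j.
  - exact: h kj.
  - by apply: (h k j) => //; rewrite eq_sym.
  - by rewrite jk' eqxx in jk.
exists (j - k)%N.
  by rewrite subn_gt0 kj (leq_trans (leq_subr _ _))// -ltnS.
have -> : expi2pi ((j - k)%:R * t) = expi2pi (fr j - fr k).
  rewrite natrB ?(ltnW kj)// /fr.
  have -> : (j%:R - k%:R) * t = ((Num.floor (j%:R * t))%:~R -
     (Num.floor (k%:R * t))%:~R) + (j%:R * t - (Num.floor (j%:R * t))%:~R -
     (k%:R * t - (Num.floor (k%:R * t))%:~R)) :> R by ring.
  by apply: e2piD_int; rewrite rpredB// intr_int.
rewrite -[X in _ - X](e2pi0 R); apply: le_trans (e2pi_lip _ _) _.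
rewrite subr0 ler_wpM2l ?mulr_ge0 ?pi_ge0//.
rewrite -[leRHS]mul1r ler_pdivlMr//.
have /andP[fj0 fj1] := fr01 j; have /andP[fk0 fk1] := fr01 k.
have /andP[] := truncn_itv (mulr_ge0 (ltW Q0') fj0).
have /andP[] := truncn_itv (mulr_ge0 (ltW Q0') fk0).
rewrite fjk -natr1 => h1 h2 h3 h4.
have : `|Q%:R * (fr j - fr k)| <= 1 by rewrite ler_norml; apply/andP; split; lra.
by rewrite normrM (ger0_norm (ltW Q0')) mulrC.
Qed.

(** Induction on [s]: a time [n] that is good for the tail up to [e / Q] may be multiplied by any
    [j <= Q], and Dirichlet provides such a [j] for [n * a]. A final factor [u + 1] makes the time
    large, so the precision asked for at first is [e / (u + 1)]. *)
Lemma simultaneous_recurrence (R : realType) (s : seq R) (e : R) u : 0 < e ->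
  exists2 n, (u <= n)%N & forall t, t \in s -> nrm (expi2pi (n%:R * t) - 1) <= e.
Proof.
move=> e0.
suff [n n0 hn] : exists2 n, (0 < n)%N &
    forall t, t \in s -> nrm (expi2pi (n%:R * t) - 1) <= e / u.+1%:R.
  exists (u.+1 * n)%N.
    by rewrite (leq_trans (leqnSn u))// leq_pmulr.
  move=> t /hn h; rewrite natrM -mulrA; apply: le_trans (e2pi_mulrn_near1 _ _) _.
  by rewrite mulrC -ler_pdivlMr.
have : 0 < e / u.+1%:R by rewrite divr_gt0.
elim: s (e / _) => {u e e0} [|a s ih] e e0; first by exists 1%N.
pose Q := (Num.truncn (4 * pi / e)).+1.
have Q0 : 0 < Q%:R :> R by rewrite ltr0n.
have [n n0 hn] := ih (e / Q%:R) ltac:(by rewrite divr_gt0).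
have [j /andP[j0 jQ] hj] := @dirichlet R (n%:R * a) Q isT.
exists (j * n)%N; first by rewrite muln_gt0 j0.
move=> t; rewrite inE => /predU1P[->|ts]; rewrite natrM -mulrA.
  apply: le_trans hj _; rewrite ler_pdivrMr// [leRHS]mulrC -ler_pdivrMr//.
  exact/ltW/truncnS_gt.
apply: le_trans (e2pi_mulrn_near1 _ _) _.
have := hn t ts; rewrite ler_pdivlMr//; apply: le_trans.
by rewrite mulrC ler_wpM2l ?nrm_ge0// ler_nat.
Qed.

Section decomposition.
Context (R : realType) (H : completeNormedModType R[i]).
Context (dot : {dot H for @Num.conj R[i]}) (hdot : induces_norm dot).
Context (T : {linear H -> H}) (M : R).
Context (hT : forall n x, nrm (iter n T x) <= M * nrm x).

(** Scalars are absorbed by the eigenvectors and eigenvalues may repeat, so that proofs are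
    inductions on the sum. *)
Inductive eigspan : H -> Prop :=
| eigspan0 : eigspan 0
| eigspan_add t v y : T v = expi2pi t *: v -> eigspan y -> eigspan (v + y).

Lemma eigspanD y y' : eigspan y -> eigspan y' -> eigspan (y + y').
Proof.
move=> hy hy'; elim: hy => [|t v w tv _ ih]; first by rewrite add0r.
by rewrite -addrA; exact: eigspan_add tv ih.
Qed.

Lemma eigspanZ a y : eigspan y -> eigspan (a *: y).
Proof.
elim=> [|t v w tv _ ih]; [rewrite scaler0; exact: eigspan0|].
rewrite scalerDr; apply: (eigspan_add (t := t)) ih.
by rewrite linearZ/= tv !scalerA mulrC.
Qed.

Lemma iter_eigenvector t v n : T v = expi2pi t *: v ->
  iter n T v = expi2pi (n%:R * t) *: v.
Proof.
move=> tv; elim: n => [|n ih]; first by rewrite mul0r e2pi0 scale1r.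
by rewrite iterS ih linearZ/= tv scalerA -e2piD -natr1 mulrDl mul1r.
Qed.

(** The orbit of [y] returns arbitrarily close to [y] at some time [n >= u], and
    [T^n y = T^(n-u) (T^u y)] has norm at most [M * nrm (iter u T y)]. The constant [C] depends on
    [y] but is beaten by the precision of the return. *)
Lemma eigspan_coercive y u : eigspan y -> nrm y <= M * nrm (iter u T y).
Proof.
move=> hy; have [s [C [C0 hs]]] : exists s : seq R, exists C : R, 0 <= C /\
    forall n (e : R), (forall t, t \in s -> nrm (expi2pi (n%:R * t) - 1) <= e) ->
    nrm (iter n T y - y) <= C * e.
  elim: hy => [|t v w tv _ [s [C [C0 ih]]]].
    by exists [::], 0; split => // n e _; rewrite linear0 subrr nrm0 mul0r.
  exists (t :: s), (nrm v + C); split; first by rewrite addr_ge0 ?nrm_ge0.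
  move=> n e he; rewrite linearD/= opprD addrACA mulrDl.
  apply: le_trans (nrmD _ _) _; apply: lerD.
    rewrite (iter_eigenvector n tv) -{2}[v]scale1r -scalerBl nrmZ mulrC.
    by rewrite ler_wpM2l ?nrm_ge0// he// mem_head.
  by apply: ih => t' t's; apply: he; rewrite inE t's orbT.
apply/ler_addgt0Pr => e e0.
have C1 : 0 < C + 1 by rewrite ltr_wpDl.
have [n un hn] := @simultaneous_recurrence R s (e / (C + 1)) u ltac:(by rewrite divr_gt0).
have h : nrm (iter n T y - y) <= e.
  apply: le_trans (hs _ _ hn) _; rewrite mulrA ler_pdivrMr// mulrC.
  by rewrite ler_wpM2l ?lerDl// ltW.
have := nrmD (iter n T y) (y - iter n T y); rewrite addrC subrK nrmB.
move=> /le_trans; apply; apply: lerD => //.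
by rewrite -(subnK un) iterD; exact: hT.
Qed.

(** Divided by [K], this is the functional to be minimised. A mean over the orbit is taken because
    the cross term with an eigenvector then becomes a mean ergodic sum; a unimodular twist of [T]
    does not change it. *)
Definition orbit_sqr K v : R := \sum_(0 <= u < K) nrm (iter u T v) ^+ 2.

Lemma iter_twist_le t n x : nrm (iter n (expi2pi t \*: T) x) <= M * nrm x.
Proof. by rewrite iter_scale nrmZ -e2pi_nat nrm_e2pi mul1r. Qed.

Lemma orbit_sqr_twist t K v :
  orbit_sqr K v = \sum_(0 <= u < K) nrm (iter u (expi2pi t \*: T) v) ^+ 2.
Proof.
by apply: eq_bigr => u _; rewrite iter_scale nrmZ -e2pi_nat nrm_e2pi mul1r.
Qed.

Lemma decomposition x : exists y z, [/\ x = y + z,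
  (forall e : R, 0 < e -> exists2 y', eigspan y' & nrm (y - y') <= e) &
  forall t, mean_null (expi2pi t \*: T) z].
Proof.
pose ev t y := \forall K \near \oo, orbit_sqr K (x - y) <= t * K%:R.
have [d [d_lb d_inf]] : exists d,
    (forall t, (exists2 y, eigspan y & ev t y) -> d <= t) /\
    (forall e, 0 < e -> exists2 t, (exists2 y, eigspan y & ev t y) & t < d + e).
  apply: real_inf_approx.
    exists ((M * nrm x) ^+ 2), 0; first exact: eigspan0.
    near=> K; rewrite /orbit_sqr subr0 mulr_natr -{2}[K]subn0 -sumr_const_nat.
    apply: ler_sum => u _.
    by rewrite lerXn2r ?nnegrE ?nrm_ge0 ?hT// (le_trans (nrm_ge0 _) (hT 0 x)).
  move=> t [y _ [N _ /(_ N.+1 (leqnSn _))]] h.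
  have : 0 <= t * N.+1%:R.
    by apply: le_trans h; apply: sumr_ge0 => u _; exact: sqr_ge0.
  by rewrite pmulr_lge0.
have [y hy] : exists y, forall e d' : R, 0 < e -> 0 < d' ->
    exists2 v, eigspan v /\ ev (d + d') v & nrm (y - v) <= e.
  apply: nested_limit => [d1 d2 v d12 [hv h]|d1 d1_gt0|e e0].
  - split=> //; apply: filterS h => K /le_trans; apply.
    by rewrite ler_wpM2r// lerD2l.
  - have [t [v hv ht] td] := d_inf _ d1_gt0; exists v; split=> //.
    by apply: filterS ht => K /le_trans; apply; rewrite ler_wpM2r// ltW.
  (* Near-minimality of [v] and [w], with the midpoint not below [d - d1], leaves [8 * d1] for the
     orbit mean of [v - w]; coercivity costs the factor [M ^+ 2]. *)
  pose c := 8 * (M ^+ 2 + 1).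
  have c0 : 0 < c by rewrite mulr_gt0// ltr_wpDl// sqr_ge0.
  have d1_gt0 : 0 < e ^+ 2 / c by rewrite divr_gt0// exprn_gt0.
  exists (e ^+ 2 / c) => // v w [hv ev_v] [hw ev_w].
  set d1 := e ^+ 2 / c in d1_gt0 ev_v ev_w *.
  pose m := 2^-1 *: (v + w).
  have hm : eigspan m by apply: eigspanZ; exact: eigspanD.
  have nev : ~ ev (d - d1) m.
    move=> h; have : d <= d - d1 by apply: d_lb; exists m.
    by lra.
  have [K K0 hK] : exists2 K, (0 < K)%N & orbit_sqr K (v - w) <= 8 * d1 * K%:R.
    apply: contrapT => /forall2NP hK; apply: nev; near=> K.
    have K0 : (0 < K)%N by near: K; exact: nbhs_infty_gt.
    case: (hK K) => // /negP; rewrite -ltNge => {}hK.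
    have h1 : orbit_sqr K (x - v) <= (d + d1) * K%:R by near: K.
    have h2 : orbit_sqr K (x - w) <= (d + d1) * K%:R by near: K.
    have : orbit_sqr K (v - w) + 4 * orbit_sqr K (x - m) =
        2 * orbit_sqr K (x - v) + 2 * orbit_sqr K (x - w).
      rewrite /orbit_sqr !mulr_sumr -!big_split/=; apply: eq_bigr => u _.
      rewrite -(parallelogram hdot) -linearD/= -linearB/=.
      have -> : x - v - (x - w) = - (v - w) by rewrite opprB addrC addrA subrK opprB.
      have -> : x - v + (x - w) = (x - m) *+ 2.
        rewrite addrACA -opprD mulrnBl mulr2n; congr (_ - _).
        by rewrite /m -scaler_nat scalerA mulfV ?pnatr_eq0// scale1r.
      rewrite raddfN nrmN raddfMn nrmMn exprMn.
      by rewrite -natrX addrC mulrC.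
    by lra.
  (* Some orbit point is not above the mean, and a single small orbit point suffices for
     [eigspan_coercive]. *)
  have [u hu] : exists u, nrm (iter u T (v - w)) ^+ 2 <= 8 * d1.
    apply: contrapT => /forallNP h; move: hK; apply/negP; rewrite -ltNge.
    rewrite mulr_natr -{1}[K]subn0 -sumr_const_nat.
    apply: ltr_sum_nat => // i _; rewrite ltNge; exact/negP/h.
  have hvw : eigspan (v - w).
    by apply: eigspanD => //; rewrite -scaleN1r; exact: eigspanZ.
  have hco := eigspan_coercive u hvw.
  rewrite -(@ler_pXn2r _ 2)// ?nnegrE ?nrm_ge0//; last exact: ltW.
  apply: (@le_trans _ _ ((M * nrm (iter u T (v - w))) ^+ 2)).
    by rewrite lerXn2r ?nnegrE ?nrm_ge0// (le_trans (nrm_ge0 _) hco).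
  rewrite exprMn.
  apply: (@le_trans _ _ (M ^+ 2 * (8 * d1))); first by rewrite ler_wpM2l ?sqr_ge0.
  have -> : e ^+ 2 = c * d1 by rewrite mulrC divfK// gt_eqF.
  by rewrite /c; nra.
exists y, (x - y); split.
- by rewrite addrC subrK.
- by move=> e e0; have [v [hv _] yv] := hy e 1 e0 ltr01; exists v.
move=> t; pose S := expi2pi t \*: T.
have [v Sv hv] := mean_ergodic hdot (iter_twist_le t) (x - y).
(* A fixed vector of [S] is an eigenvector of [T], so [v + w] stays in the span when [w] is in it.
   As the means of [S^n (x - w)] are close to [v], passing from [w] to [v + w] would lower the orbit
   mean by nearly [nrm v ^+ 2]. *)
suff v0 : v = 0 by rewrite v0 subr0 in hv.
have Snv n : iter n S v = v by elim: n => //= n ->.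
have Tv : T v = expi2pi (- t) *: v.
  by rewrite -{2}Sv scalerA -e2piD addNr e2pi0 scale1r.
apply/eqP; rewrite -nrm_eq0; apply/negPn/negP => nv.
have {}nv : 0 < nrm v by rewrite lt_def nv nrm_ge0.
have M0 : 0 < `|M| + 1 by rewrite ltr_wpDl.
have [w [hw ev_w] yw] := hy (nrm v / 8 / (`|M| + 1)) (nrm v ^+ 2 / 4)
  ltac:(by rewrite !divr_gt0) ltac:(by rewrite divr_gt0 ?exprn_gt0).
(* In units of [nrm v ^+ 2], the losses are [1/4] from [w] being only nearly minimal and [1/2] from
   the two means of norm at most [nrm v / 8]; the gain is 1. *)
have : d <= d + nrm v ^+ 2 / 4 - nrm v ^+ 2 + 2 * (nrm v / 4 * nrm v).
  apply: d_lb; exists (v + w); first exact: eigspan_add Tv hw.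
  have hv' := hv (nrm v / 8) ltac:(by rewrite divr_gt0).
  near=> K.
  have hK : orbit_sqr K (x - w) <= (d + nrm v ^+ 2 / 4) * K%:R by near: K.
  have hvK : nrm (\sum_(0 <= n < K) iter n S (x - y - v)) <= nrm v / 8 * K%:R.
    have : forall c, [set: unit] c ->
      nrm (\sum_(0 <= n < K) iter n S (x - y - v)) <= nrm v / 8 * K%:R by near: K.
    by apply.
  have hyK : nrm (\sum_(0 <= n < K) iter n S (y - w)) <= nrm v / 8 * K%:R.
    apply: nrm_nat_sum => n _; apply: le_trans (iter_twist_le _ _ _) _.
    move: yw; rewrite ler_pdivlMr//; apply: le_trans.
    by rewrite mulrC ler_wpM2l ?nrm_ge0// (le_trans (ler_norm M))// lerDl.
  have -> : orbit_sqr K (x - (v + w)) = orbit_sqr K (x - w) + nrm v ^+ 2 * K%:R -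
      2 * complex.Re (dot (\sum_(0 <= n < K) iter n S (x - w)) v).
    have -> : nrm v ^+ 2 * K%:R = \sum_(0 <= n < K) nrm v ^+ 2.
      by rewrite sumr_const_nat subn0 mulr_natr.
    rewrite !(orbit_sqr_twist t) dot_suml raddf_sum/= mulr_sumr -big_split/= -sumrB.
    apply: eq_bigr => n _.
    rewrite opprD addrCA addrC -/S linearB/= Snv (nrm_sqrB hdot).
    by ring.
  have -> : \sum_(0 <= n < K) iter n S (x - w) =
      \sum_(0 <= n < K) iter n S (x - y - v) + \sum_(0 <= n < K) iter n S (y - w) +
      K%:R *: v.
    have -> : K%:R *: v = \sum_(0 <= n < K) iter n S v.
      under eq_bigr do rewrite Snv.
      by rewrite sumr_const_nat subn0 scaler_nat.
    rewrite -!big_split/=; apply: eq_bigr => n _; rewrite -!linearD/=.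
    by congr (iter n S _); rewrite addrAC subrK addrA subrK.
  set A := \sum_(_ <= _ < _) _; set B := \sum_(_ <= _ < _) _.
  have -> : complex.Re (dot (A + B + K%:R *: v) v) =
      complex.Re (dot A v) + complex.Re (dot B v) + nrm v ^+ 2 * K%:R.
    have -> : dot (A + B + K%:R *: v) v = dot A v + dot B v + dot v v *+ K.
      by rewrite linearDl/= linearDl/= scaler_nat linearMnl.
    by rewrite !raddfD raddfMn/= -(nrm_sqr hdot) mulr_natr.
  have hA : - (nrm v / 8 * K%:R * nrm v) <= complex.Re (dot A v).
    rewrite lerNl; apply: (@le_trans _ _ (nrm A * nrm v)); last first.
      by rewrite ler_wpM2r ?nrm_ge0.
    by apply: le_trans (dot_le hdot _ _); rewrite -raddfN -nrmN; exact: Re_le_nrm.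
  have hB : - (nrm v / 8 * K%:R * nrm v) <= complex.Re (dot B v).
    rewrite lerNl; apply: (@le_trans _ _ (nrm B * nrm v)); last first.
      by rewrite ler_wpM2r ?nrm_ge0.
    by apply: le_trans (dot_le hdot _ _); rewrite -raddfN -nrmN; exact: Re_le_nrm.
  by lra.
by have := exprn_gt0 2 nv; lra.
Unshelve. all: by end_near. Qed.

End decomposition.

(** * Arbitrary bounded weights *)

Section unit_weights.
Context (R : realType).

Definition unit_weight : set (nat -> R[i]) := [set c | forall n, nrm (c n) <= 1].

End unit_weights.
Arguments unit_weight {R}.

Section parseval.
Context (R : realType) (H : completeNormedModType R[i]).
Context (dot : {dot H for @Num.conj R[i]}) (hdot : induces_norm dot).

Lemma parseval N (f : nat -> H) :
  \sum_(0 <= m < N) nrm (\sum_(0 <= k < N) expi2pi (m%:R * (k%:R / N%:R)) *: f k) ^+ 2 =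
  N%:R * \sum_(0 <= k < N) nrm (f k) ^+ 2.
Proof.
under eq_bigr do rewrite (nrm_sqr hdot) dot_suml raddf_sum/=.
rewrite exchange_big/= mulr_sumr; apply: eq_big_nat => k /andP[_ kN].
transitivity (\sum_(0 <= l < N) (if l == k then N%:R * complex.Re (dot (f k) (f l)) else 0)).
  under eq_bigr do rewrite dot_sumr raddf_sum/=.
  rewrite exchange_big/=; apply: eq_big_nat => l /andP[_ lN].
  rewrite -raddf_sum/=.
  under eq_bigr do rewrite (dotZ dot) -e2piN -e2piD.
  rewrite -mulr_suml (eq_bigr (fun m => expi2pi ((k%:R - l%:R) / N%:R * m%:R))).
    rewrite sum_e2pi_orthogonal// eq_sym; case: eqP => _.
      by rewrite !mulr_natl raddfMn.
    by rewrite mul0r raddf0.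
  by move=> m _; congr expi2pi; ring.
by rewrite (nat_sum_delta (fun l => N%:R * complex.Re (dot (f k) (f l))))// -nrm_sqr.
Qed.

(* Convolution with [y] is diagonalised by the discrete Fourier transform
   modulo [N + W], so its norm on square summable weights is at most the
   maximum of the symbol [sum_w e(w t) y_w]. *)
Lemma convolution_le (c : nat -> R[i]) (y : nat -> H) W N b :
  (forall t, nrm (\sum_(0 <= w < W) expi2pi (w%:R * t) *: y w) <= b) ->
  \sum_(0 <= m < N) nrm (\sum_(0 <= w < W) c (m + w)%N *: y w) ^+ 2 <=
  b ^+ 2 * \sum_(0 <= n < N + W) nrm (c n) ^+ 2.
Proof.
move=> hb; have b0 : 0 <= b by exact: le_trans (nrm_ge0 _) (hb 0).
(* Parseval for scalars is read off from the vector-valued identity along a fixed [v != 0], which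
   sets the zero space apart. *)
have [[v v0]|nv] := pselect (exists v : H, v != 0); last first.
  have H0 (v : H) : v = 0.
    by apply/eqP/negPn/negP => v0; apply: nv; exists v.
  rewrite big1 ?mulr_ge0 ?sqr_ge0//; first by apply: sumr_ge0 => n _; exact: sqr_ge0.
  by move=> m _; rewrite (H0 (\sum_(_ <= _ < _) _)) nrm0 expr0n.
(* For [m < N] and [w < W] the index [m + w] stays below [L], so the cyclic convolution does not
   wrap around. *)
set L := (N + W)%N.
have [L0|L0] := posnP L.
  have N0 : N = 0%N by apply/eqP; rewrite -leqn0 -L0 leq_addr.
  rewrite N0 big_geq// mulr_ge0 ?sqr_ge0//.
  by apply: sumr_ge0 => n _; exact: sqr_ge0.
have L0' : 0 < L%:R :> R by rewrite ltr0n.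
pose Y t := \sum_(0 <= w < W) expi2pi (w%:R * t) *: y w.
pose ch (k : nat) := \sum_(0 <= n < L) c n * Num.conj (expi2pi (k%:R * (n%:R / L%:R))).
have parseval_c : \sum_(0 <= k < L) nrm (ch k) ^+ 2 = L%:R * \sum_(0 <= n < L) nrm (c n) ^+ 2.
  have v2 : nrm v ^+ 2 != 0 by rewrite sqrf_eq0 nrm_eq0.
  apply: (mulIf v2); rewrite mulr_suml -mulrA mulr_suml.
  have := parseval L (fun n => Num.conj (c n) *: v).
  under [X in _ = _ * X -> _]eq_bigr do rewrite nrmZ nrm_conj exprMn.
  move=> <-; apply: eq_bigr => k _; rewrite -exprMn -nrm_conj -nrmZ; congr (nrm _ ^+ 2).
  rewrite rmorph_sum/= scaler_suml; apply: eq_bigr => n _.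
  by rewrite rmorphM/= conjCK scalerA mulrC.
have inv m : (m < N)%N -> L%:R *: (\sum_(0 <= w < W) c (m + w)%N *: y w) =
    \sum_(0 <= k < L) expi2pi (m%:R * (k%:R / L%:R)) *: (ch k *: Y (k%:R / L%:R)).
  move=> mN; rewrite /Y.
  under [RHS]eq_bigr do rewrite !scaler_sumr.
  rewrite exchange_big/= scaler_sumr; apply: eq_big_nat => w /andP[_ wW].
  under [RHS]eq_bigr do rewrite !scalerA.
  rewrite -scaler_suml scalerA; congr (_ *: _).
  transitivity (\sum_(0 <= n < L) (if n == (m + w)%N then L%:R * c n else 0)).
    by rewrite (nat_sum_delta (fun n => L%:R * c n))// /L; lia.
  under [RHS]eq_bigr do rewrite /ch mulr_sumr mulr_suml.
  rewrite exchange_big/=; apply: eq_big_nat => n /andP[_ nL].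
  rewrite (eq_bigr (fun k => c n * expi2pi (((m + w)%:R - n%:R) / L%:R * k%:R))).
    rewrite -mulr_sumr sum_e2pi_orthogonal//; last by rewrite /L; lia.
    by rewrite eq_sym; case: eqP => _; rewrite ?mulr0// mulrC.
  move=> k _; rewrite mulrCA -[LHS]mulrA -e2piN -!e2piD (natrD R m w).
  by congr (_ * expi2pi _); ring.
rewrite -(ler_pM2l L0') -(ler_pM2l L0').
rewrite mulrA -expr2 mulr_sumr.
apply: (@le_trans _ _ (\sum_(0 <= m < L) nrm (\sum_(0 <= k < L)
    expi2pi (m%:R * (k%:R / L%:R)) *: (ch k *: Y (k%:R / L%:R))) ^+ 2)).
  rewrite [leRHS]nat_sumD -[leLHS]addr0; apply: lerD; last first.
    by apply: sumr_ge0 => ? _; exact: sqr_ge0.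
  apply: ler_sum_nat => m /andP[_ mN]; rewrite -inv// nrmZ.
  by rewrite -(rmorph_nat (real_complex R)) nrm_real ger0_norm// exprMn.
rewrite parseval ler_wpM2l ?(ltW L0')// mulrCA -parseval_c mulr_sumr.
apply: ler_sum => k _; rewrite nrmZ exprMn mulrC ler_wpM2r ?sqr_ge0//.
by rewrite lerXn2r ?nnegrE ?nrm_ge0// hb.
Qed.

End parseval.

Section unstructured.
Context (R : realType) (H : completeNormedModType R[i]).
Context (dot : {dot H for @Num.conj R[i]}) (hdot : induces_norm dot).
Context (T : {linear H -> H}) (M : R) (M0 : 0 < M).
Context (hT : forall n x, nrm (iter n T x) <= M * nrm x).
Context (z : H) (hz : forall t, mean_null (expi2pi t \*: T) z).

Let expsum N (t : R) : H := \sum_(0 <= u < N) expi2pi (u%:R * t) *: iter u T z.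

Let expsumE N t : expsum N t = \sum_(0 <= u < N) iter u (expi2pi t \*: T) z.
Proof. by apply: eq_bigr => u _; rewrite iter_scale -e2pi_nat mulrC. Qed.

Let expsum_lip N t s :
  nrm (expsum N t - expsum N s) <= 4 * pi * N%:R * `|t - s| * (M * nrm z) * N%:R.
Proof.
rewrite /expsum -sumrB; apply: nrm_nat_sum => u uN.
rewrite -scalerBl nrmZ; apply: ler_pM; rewrite ?nrm_ge0//.
apply: le_trans (e2pi_lip _ _) _; rewrite -mulrBr normrM ger0_norm// mulrA.
by rewrite ler_wpM2r// ler_wpM2l ?mulr_ge0 ?pi_ge0// ler_nat ltnW.
Qed.

(** Each block of length [K] is the image of the first one under a power of the twisted operator,
    which costs a factor [M]; fewer than [K] terms are left over. Smallness at one length thus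
    passes to all large lengths. *)
Let expsum_blocks N K t b : (0 < K)%N -> nrm (expsum K t) <= b * K%:R ->
  nrm (expsum N t) <= M * b * N%:R + M * nrm z * K%:R.
Proof.
move=> K0 hK; rewrite expsumE in hK; rewrite expsumE.
set S := expi2pi t \*: T in hK *.
have hS n x : nrm (iter n S x) <= M * nrm x by exact: iter_twist_le.
have b0 : 0 <= b.
  by rewrite -(@pmulr_lge0 _ K%:R) ?ltr0n//; exact: le_trans (nrm_ge0 _) hK.
have -> : \sum_(0 <= u < N) iter u S z =
    \sum_(0 <= r < K) \sum_(0 <= j < N %/ K) iter (j * K + r) S z +
    \sum_(0 <= r < N %% K) iter (N %/ K * K + r) S z.
  by rewrite -nat_sumM -nat_sumD -divn_eq.
rewrite exchange_big/=.
apply: le_trans (nrmD _ _) _; apply: lerD.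
  apply: (@le_trans _ _ (M * (b * K%:R) * (N %/ K)%:R)).
    apply: nrm_nat_sum => j _.
    under eq_bigr do rewrite iterD.
    rewrite -linear_sum/=; apply: le_trans (hS _ _) _.
    by rewrite ler_wpM2l// ltW.
  rewrite -!mulrA ler_wpM2l ?(ltW M0)// ler_wpM2l// -natrM ler_nat.
  by rewrite mulnC leq_divM.
apply: (@le_trans _ _ (M * nrm z * (N %% K)%:R)).
  by apply: nrm_nat_sum => j _; exact: hS.
by rewrite ler_wpM2l ?mulr_ge0 ?nrm_ge0 ?(ltW M0)// ler_nat ltnW// ltn_mod.
Qed.

(** At a fixed length the sum is Lipschitz in [t], which gives a neighbourhood; [expsum_blocks] then
    reaches every large [N], so that one [N] serves a finite subcover of [[0, 1]]. *)
Lemma uniform_mean_null (e : R) : 0 < e ->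
  exists2 K, (0 < K)%N & forall t, nrm (expsum K t) <= e * K%:R.
Proof.
move=> e0.
have h01 : \forall N \near \oo, `[0, 1]%classic `<=` [set t | nrm (expsum N t) <= e * N%:R].
  have /compact_near_coveringP cpt := @segment_compact R 0 1.
  apply: (cpt nat \oo (fun N t => nrm (expsum N t) <= e * N%:R)) => t _.
  (* Moving from [t] to [s] doubles [e'] and the blocks multiply it by [M], giving [e / 2]; the
     other half is for the incomplete block. *)
  pose e' := e / (4 * M).
  have e'0 : 0 < e' by rewrite divr_gt0// mulr_gt0.
  have [K0 _ hK0] := hz t e'0.
  pose K := K0.+1; have K1 : 0 < K%:R :> R by rewrite ltr0n.
  have hK : nrm (expsum K t) <= e' * K%:R.
    by rewrite expsumE; apply: (hK0 K (leqnSn _) tt).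
  pose c := 4 * pi * K%:R * (M * nrm z) + 1.
  have c0 : 0 < c.
    by rewrite ltr_wpDl// !mulr_ge0 ?pi_ge0 ?nrm_ge0// ltW.
  have ec0 : 0 < e' / c by rewrite divr_gt0.
  exists ([set s | `|t - s| < e' / c],
    [set N | M * nrm z * K%:R <= e / 2 * N%:R]) => /=.
    split.
      by apply/nbhs_ballP; exists (e' / c) => //= s.
    near=> N; rewrite /= -ler_pdivrMl ?divr_gt0//.
    by near: N; exact: nbhs_infty_ger.
  move=> [s N] /= [ts hN].
  have hs : nrm (expsum K s) <= 2 * e' * K%:R.
    have -> : expsum K s = (expsum K s - expsum K t) + expsum K t by rewrite subrK.
    apply: le_trans (nrmD _ _) _.
    have -> : 2 * e' * K%:R = e' * K%:R + e' * K%:R by ring.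
    apply: lerD hK; apply: le_trans (expsum_lip _ _ _) _.
    apply: ler_wpM2r; first exact: ltW.
    rewrite distrC.
    have ts' : `|t - s| * c <= e' by rewrite -ler_pdivlMr// ltW.
    have : `|t - s| * (4 * pi * K%:R * (M * nrm z)) <= `|t - s| * c.
      by rewrite ler_wpM2l// lerDl.
    by lra.
  apply: le_trans (expsum_blocks _ (ltn0Sn _) hs) _.
  have -> : M * (2 * e') = e / 2 by rewrite /e'; field; rewrite gt_eqF.
  by rewrite -/K; move: hN; lra.
have [N0 _ hN0] := h01; exists N0.+1 => // t.
have -> : expsum N0.+1 t = expsum N0.+1 (t - (Num.floor t)%:~R).
  apply: eq_bigr => u _; congr (_ *: _).
  rewrite -[in LHS](subrK (Num.floor t)%:~R t) mulrDr addrC e2piD_int//.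
  by rewrite rpredM ?natr_int ?intr_int.
apply: (hN0 N0.+1 (leqnSn _)) => /=.
have := floor_itv t; rewrite intrD => /andP[? ?].
by rewrite in_itv/=; apply/andP; split; lra.
Unshelve. all: by end_near. Qed.

Definition weight_null (f : nat -> nat) :=
  mnull unit_weight (fun (c : nat -> R[i]) n => c n *: iter (f n) T z).

Lemma nrm_weighted (c : nat -> R[i]) n k : unit_weight c ->
  nrm (c n *: iter k T z) <= M * nrm z.
Proof.
by move=> hc; rewrite nrmZ -[leRHS]mul1r; apply: ler_pM; rewrite ?nrm_ge0.
Qed.

(** In a window, [T^(n+w) z = T^n (T^w z)]: the factor [T^n] costs only [M], and what remains is the
    convolution of [c] with [T^w z], whose symbol is small uniformly in the frequency. *)
Lemma weight_null_id : weight_null id.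
Proof.
apply: (mnull_window (B := M * nrm z)) => [c n hc|e e0].
  exact: nrm_weighted.
pose b := Num.min 1 (e / (2 * M ^+ 2)).
have b0 : 0 < b.
  by rewrite lt_min ltr01 divr_gt0// mulr_gt0// exprn_gt0.
have b1 : b <= 1 by rewrite ge_min lexx.
have be : b * (2 * M ^+ 2) <= e.
  rewrite -ler_pdivlMr ?mulr_gt0 ?exprn_gt0//.
  by rewrite ge_min lexx orbT.
have [W W0 hW] := uniform_mean_null b0; exists W => //.
near=> N => c hc.
apply: (@le_trans _ _ (M ^+ 2 * \sum_(0 <= n < N)
    nrm (\sum_(0 <= w < W) c (n + w)%N *: iter w T z) ^+ 2)).
  rewrite mulr_sumr; apply: ler_sum => n _; rewrite -exprMn.
  rewrite lerXn2r ?nnegrE ?nrm_ge0 ?mulr_ge0 ?nrm_ge0 ?(ltW M0)//.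
  apply: le_trans (hT n _); rewrite linear_sum/= le_eqVlt; apply/orP; left.
  by apply/eqP; congr nrm; apply: eq_bigr => w _; rewrite linearZ/= iterD.
have := @convolution_le R H dot hdot c (fun w => iter w T z) W N (b * W%:R) hW.
have : \sum_(0 <= n < N + W) nrm (c n) ^+ 2 <= 2 * N%:R.
  apply: (@le_trans _ _ (\sum_(0 <= n < N + W) 1)).
    by apply: ler_sum => n _; rewrite expr_le1 ?nrm_ge0//; exact: hc.
  rewrite sumr_const_nat subn0 natrD mulr_natl mulr2n lerD2l ler_nat.
  by near: N; exact: nbhs_infty_ge.
set S := \sum_(0 <= n < N + W) _ => hS h.
have h2 : M ^+ 2 * ((b * W%:R) ^+ 2 * S) <= M ^+ 2 * ((b * W%:R) ^+ 2 * (2 * N%:R)).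
  by rewrite !ler_wpM2l ?sqr_ge0.
apply: le_trans (ler_wpM2l (sqr_ge0 M) h) _; apply: le_trans h2 _.
have -> : M ^+ 2 * ((b * W%:R) ^+ 2 * (2 * N%:R)) =
  b * (b * (2 * M ^+ 2)) * (W%:R ^+ 2 * N%:R) by ring.
rewrite -[leRHS]mulrA; apply: ler_wpM2r; first by rewrite mulr_ge0 ?sqr_ge0.
have : b * (b * (2 * M ^+ 2)) <= 1 * e.
  apply: ler_pM => //; first exact: ltW.
  by apply: mulr_ge0; [exact: ltW|rewrite mulr_ge0 ?sqr_ge0].
by rewrite mul1r.
Unshelve. all: by end_near. Qed.

End unstructured.

(** * Polynomial times *)

Lemma near_divn (P : nat -> Prop) L : (0 < L)%N ->
  (\forall n \near \oo, P n) -> \forall n \near \oo, P (n %/ L)%N.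
Proof.
move=> L0 [N _ hN]; exists (N * L)%N => // n /= Nn; apply: hN => /=.
by rewrite leq_divRL.
Qed.

Lemma poly_upper (R : realType) (q : {poly R}) d : (size q <= d.+1)%N ->
  exists2 c, 0 <= c & forall x y, 0 <= x <= y -> 1 <= y -> `|q.[x]| <= c * y ^+ d.
Proof.
move=> sq; exists (\sum_(i < d.+1) `|q`_i|); first exact: sumr_ge0.
move=> x y /andP[x0 xy] y1; rewrite (horner_coef_wide _ sq) mulr_suml.
apply: le_trans (ler_norm_sum _ _ _) _; apply: ler_sum => i _.
rewrite normrM ler_wpM2l// normrX ger0_norm//.
apply: (@le_trans _ _ (y ^+ i)); first by rewrite lerXn2r ?nnegrE//; lra.
by rewrite ler_weXn2l// -ltnS.
Qed.

Lemma poly_lower (R : realType) (p : {poly R}) d : size p = d.+1 ->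
  0 < lead_coef p ->
  \forall n \near \oo, lead_coef p / 2 * n%:R ^+ d <= p.[n%:R].
Proof.
move=> sp lp; case: d sp => [|d] sp.
  near=> n; rewrite size1_horner ?sp// expr0 mulr1.
  by move: lp; rewrite lead_coefE sp/=; lra.
pose r := p - lead_coef p *: 'X^(d.+1).
have sr : (size r <= d.+1)%N by exact: size_sub_lead.
have [c c0 hc] := poly_upper sr.
near=> n; have n1 : 1 <= n%:R :> R by near: n; exact: nbhs_infty_ger.
have := hc n%:R n%:R; rewrite lexx ler0n => /(_ isT n1).
have -> : p.[n%:R] = lead_coef p * n%:R ^+ d.+1 + r.[n%:R].
  by rewrite hornerD hornerN hornerZ hornerXn addrC subrK.
have : c * n%:R ^+ d <= lead_coef p / 2 * n%:R ^+ d.+1.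
  rewrite exprS mulrA ler_wpM2r ?exprn_ge0// -ler_pdivrMl ?divr_gt0//.
  by near: n; exact: nbhs_infty_ger.
by rewrite ler_norml => h /andP[h1 h2]; lra.
Unshelve. all: by end_near. Qed.

(** The left-hand side is [O(N^d)], while [p] at [N %/ L >= N / (2 L)] is at least a constant times
    [N^(d+1)]; the extra power beats all constants that depend on [L]. *)
Lemma poly_small (R : realType) (q p : {poly R}) d (b : R) L :
  (size q <= d.+1)%N -> size p = d.+2 -> 0 < lead_coef p -> 0 < b -> (0 < L)%N ->
  \forall N \near \oo, forall n, (n <= N)%N ->
    `|q.[n%:R]| <= b * p.[(N %/ L)%N%:R].
Proof.
move=> sq sp lp b0 L0.
have [c c0 hc] := poly_upper sq.
have bl : 0 < b * (lead_coef p / 2) by rewrite mulr_gt0// divr_gt0.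
have h1 := near_divn L0 (poly_lower sp lp).
have h2 := near_divn L0 (nbhs_infty_ger (c * (2 * L%:R) ^+ d / (b * (lead_coef p / 2)) : R)).
near=> N => n nN.
have LN : (L <= N)%N by near: N; exact: nbhs_infty_ge.
set m := (N %/ L)%N.
have m0 : (0 < m)%N by rewrite divn_gt0.
have Nm : N%:R <= 2 * L%:R * m%:R :> R.
  rewrite -!natrM ler_nat; have := divn_eq N L; have := ltn_pmod N L0.
  rewrite -/m; nia.
have N1 : 1 <= N%:R :> R by rewrite ler1n (leq_trans L0).
apply: le_trans (hc n%:R N%:R _ N1) _; first by rewrite ler0n ler_nat nN.
apply: (@le_trans _ _ (b * (lead_coef p / 2 * m%:R ^+ d.+1))); last first.
  by rewrite ler_wpM2l ?(ltW b0)// /m; near: N; exact: h1.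
apply: (@le_trans _ _ (c * (2 * L%:R * m%:R) ^+ d)).
  by rewrite ler_wpM2l// lerXn2r ?nnegrE// !mulr_ge0.
rewrite exprMn mulrA exprSr [_ / 2 * _]mulrA [b * (_ * _)]mulrA mulrAC.
rewrite [b * _]mulrA -[leLHS]mulrA [_ ^+ d * _]mulrC mulrA.
have : c * (2 * L%:R) ^+ d / (b * (lead_coef p / 2)) <= m%:R.
  by rewrite /m; near: N; exact: h2.
rewrite ler_pdivrMr// => /(ler_wpM2r (exprn_ge0 d (ler0n R m))).
by lra.
Unshelve. all: by end_near. Qed.

Lemma sum_interval_le a m N :
  (\sum_(0 <= n < N) ((a <= n) && (n < a + m)) <= m)%N.
Proof.
suff : (\sum_(0 <= n < N) ((a <= n) && (n < a + m)) <= minn N (a + m) - a)%N by lia.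
elim: N => [|N ih]; first by rewrite big_geq.
by rewrite big_nat_recr//=; lia.
Qed.

Lemma sum_fibre_le (f : nat -> nat) m j N :
  (forall n n', (n <= n')%N -> f n = f n' -> (n' < n + m)%N) ->
  (\sum_(0 <= n < N) (f n == j) <= m)%N.
Proof.
move=> hf; have [[a fa]|nex] := pselect (exists n, f n == j); last first.
  by rewrite big1// => n _; case: eqP => // fn; case: nex; exists n; apply/eqP.
have [b fb bmin] := ex_minnP (ex_intro (fun n => f n == j) a fa).
apply: leq_trans (sum_interval_le b m N); apply: leq_sum => n _.
case: eqP => //= fn; rewrite bmin ?fn//= hf ?bmin ?fn//.
by rewrite (eqP fb).
Qed.

Section polynomial_times.
Context (R : realType) (H : completeNormedModType R[i]).
Context (dot : {dot H for @Num.conj R[i]}) (hdot : induces_norm dot).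
Context (T : {linear H -> H}) (M : R) (M0 : 0 < M).
Context (hT : forall n x, nrm (iter n T x) <= M * nrm x).
Context (z : H).

(** Terms with equal exponent are collected. A fibre has at most [m] elements, so the sum of [c]
    over it, divided by [m], is again a weight bounded by 1; the linear growth of [f] keeps the new
    range proportional to [N]. *)
Lemma weight_null_fibres f m C : (0 < m)%N ->
  (forall n n', (n <= n')%N -> f n = f n' -> (n' < n + m)%N) ->
  (forall n, (f n <= C * n.+1)%N) ->
  weight_null T z id -> weight_null T z f.
Proof.
move=> m0 hf fC hid e e0.
have m0' : 0 < m%:R :> R by rewrite ltr0n.
have hN := hid (e / (m * C.+1)%:R) ltac:(by rewrite divr_gt0// ltr0n muln_gt0 m0).
have [N0 _ {}hN] := hN.
near=> N => c hc; pose J := (C.+1 * N)%N.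
have NJ : (N0 <= J)%N.
  by rewrite /J mulSn (leq_trans _ (leq_addr _ _))//; near: N; exact: nbhs_infty_ge.
pose c' j : R[i] := m%:R^-1 * \sum_(0 <= n < N) (f n == j)%:R * c n.
have c'1 : unit_weight c'.
  move=> j; rewrite nrmM nrm_natV ler_pdivrMl// mulr1.
  apply: le_trans (nrm_sum _ _ _) _.
  apply: (@le_trans _ _ (\sum_(0 <= n < N) (f n == j)%:R)).
    apply: ler_sum => n _; rewrite nrmM.
    have -> : nrm ((f n == j)%:R : R[i]) = (f n == j)%:R.
      by case: (f n == j); rewrite ?nrm1 ?nrm0.
    by rewrite ler_piMr//; exact: hc.
  by rewrite -natr_sum ler_nat sum_fibre_le.
have := hN J NJ c' c'1.
have -> : \sum_(0 <= j < J) c' j *: iter j T z =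
    m%:R^-1 *: \sum_(0 <= n < N) c n *: iter (f n) T z.
  under eq_bigr do rewrite /c' -scalerA scaler_suml.
  rewrite -scaler_sumr exchange_big/=; congr (_ *: _).
  apply: eq_big_nat => n /andP[_ nN].
  rewrite -(@nat_sum_delta _ (fun j => c n *: iter j T z) (f n) J).
    apply: eq_bigr => j _; rewrite eq_sym; case: eqP => _.
      by rewrite mul1r.
    by rewrite mul0r scale0r.
  by rewrite /J; have := fC n; nia.
rewrite nrmZ nrm_natV ler_pdivrMl// => /le_trans; apply.
rewrite /J !natrM invfM le_eqVlt; apply/orP; left; apply/eqP.
by field; rewrite !gt_eqF// ?ltr0n// ltr_wpDr.
Unshelve. all: by end_near. Qed.

Lemma weight_null_linear (p : {poly R}) : size p = 2%N -> 0 < lead_coef p ->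
  weight_null T z id -> weight_null T z (fun n => Num.truncn p.[n%:R]).
Proof.
move=> sp lp; set al := lead_coef p in lp; pose b := p`_0.
have pE n : p.[n%:R] = b + al * n%:R by rewrite size2_horner.
(* The 1 covers the rounding, and [|b|] the initial stretch on which [p] may be negative and is
   truncated to 0. *)
pose m := (Num.truncn ((`|b| + 1) / al)).+1.
pose C := (Num.truncn (al + `|b|)).+1.
have hm : `|b| + 1 < m%:R * al by rewrite -ltr_pdivrMr// truncnS_gt.
have hC : al + `|b| < C%:R by exact: truncnS_gt.
have trunc_lt (x : R) : x < (Num.truncn x).+1%:R by exact: truncnS_gt.
apply: (@weight_null_fibres _ m C) => // [n n' nn' fnn'|n]; last first.
  rewrite truncn_le_nat pE -natr1 natrM -[n.+1%:R]natr1.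
  have n0 : 0 <= n%:R :> R by [].
  have b0 : b <= `|b| by exact: ler_norm.
  have b00 : 0 <= `|b| by [].
  by nra.
rewrite -(ltr_nat R) natrD -(ltr_pM2r lp).
have h1 := trunc_lt p.[n'%:R]; rewrite -fnn' -natr1 pE in h1.
have n0 : 0 <= n%:R :> R by [].
have bb : - b <= `|b| by rewrite -normrN; exact: ler_norm.
have [p0|p0] := leP 0 p.[n%:R].
  have /andP[h2 _] := truncn_itv p0; rewrite [leRHS]pE in h2.
  have b00 : 0 <= `|b| by [].
  by lra.
have h2 : Num.truncn p.[n%:R] = 0%N by apply/truncn0Pn; rewrite -ltNge; lra.
rewrite h2 in h1; nra.
Qed.

End polynomial_times.

Lemma truncn_subr (R : archiRealFieldType) (a b : R) : 0 <= b <= a ->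
  (Num.truncn a - Num.truncn b)%N = Num.truncn (a - b) \/
  (Num.truncn a - Num.truncn b)%N = (Num.truncn (a - b)).+1.
Proof.
move=> /andP[b0 ba]; have a0 := le_trans b0 ba.
have ab0 : 0 <= a - b by rewrite subr_ge0.
have /andP[a1 a2] := truncn_itv a0; have /andP[b1 b2] := truncn_itv b0.
have /andP[c1 c2] := truncn_itv ab0.
rewrite -natr1 in a2; rewrite -natr1 in b2; rewrite -natr1 in c2.
have h1 : (Num.truncn a < Num.truncn b + Num.truncn (a - b) + 2)%N.
  by rewrite -(ltr_nat R) !natrD; lra.
have h2 : (Num.truncn b + Num.truncn (a - b) < Num.truncn a + 1)%N.
  by rewrite -(ltr_nat R) !natrD; lra.
by lia.
Qed.

Lemma poly_eventually_mono (R : realType) (p : {poly R}) d :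
  size p = d.+2 -> 0 < lead_coef p ->
  exists n1, forall n w, (n1 <= n)%N -> 0 <= p.[n%:R] <= p.[(n + w)%N%:R].
Proof.
move=> sp lp; have [sq lq] := diff_shift_poly sp (ltnSn 0).
have lq0 : 0 < lead_coef (shift_poly p 1 - shift_poly p 0).
  by rewrite lq mulr_gt0// ltr0n muln_gt0.
have [n1 _ h1] := poly_lower sp lp; have [n2 _ h2] := poly_lower sq lq0.
exists (maxn n1 n2) => n w; rewrite geq_max => /andP[n1n n2n].
have p0 : 0 <= p.[n%:R].
  by apply: le_trans (h1 n n1n); rewrite mulr_ge0 ?exprn_ge0// divr_ge0// ltW.
rewrite p0/=; elim: w => [|w ih]; first by rewrite addn0.
have /= := h2 (n + w)%N (leq_trans n2n (leq_addr _ _)).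
rewrite hornerD hornerN !horner_shift_poly addn0 addn1 addnS => h.
apply: le_trans ih _; rewrite -subr_ge0; apply: le_trans h.
by rewrite mulr_ge0 ?exprn_ge0// divr_ge0// ltW.
Qed.

Section van_der_corput.
Context (R : realType) (H : completeNormedModType R[i]).
Context (dot : {dot H for @Num.conj R[i]}) (hdot : induces_norm dot).
Context (T : {linear H -> H}) (M : R) (M0 : 0 < M).
Context (hT : forall n x, nrm (iter n T x) <= M * nrm x).
Context (z : H) (G : R) (hG : forall u, nrm (iter u T z) <= G).

(** Averaging over [u < K] the bound on [T^P y = T^(P-u) (T^u y)] trades one orbit point for a sum
    that hardly changes when [u] is shifted. *)
Lemma orbit_sqr_pull K P y : (K <= P)%N ->
  K%:R * nrm (iter P T y) ^+ 2 <= M ^+ 2 * orbit_sqr T K y.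
Proof.
move=> KP; rewrite mulr_natl -{1}[K]subn0 -sumr_const_nat mulr_sumr.
apply: ler_sum_nat => u /andP[_ uK]; rewrite -exprMn.
rewrite lerXn2r ?nnegrE ?nrm_ge0 ?mulr_ge0 ?nrm_ge0 ?(ltW M0)//.
by rewrite -(subnK (ltnW (leq_trans uK KP))) iterD.
Qed.

Definition correlation K r s : R[i] :=
  \sum_(0 <= u < K) dot (iter (u + r) T z) (iter (u + s) T z).

Let G0 : 0 <= G.
Proof. exact: le_trans (nrm_ge0 _) (hG 0). Qed.

Let dotG u v : nrm (dot (iter u T z) (iter v T z)) <= G ^+ 2.
Proof.
apply: le_trans (dot_le hdot _ _) _.
by rewrite expr2; apply: ler_pM; rewrite ?nrm_ge0 ?hG.
Qed.

Lemma correlation_conj K r s : Num.conj (correlation K r s) = correlation K s r.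
Proof. by rewrite rmorph_sum/=; apply: eq_bigr => u _; rewrite -dot_conj. Qed.

Lemma nrm_correlation K r s : nrm (correlation K r s) <= G ^+ 2 * K%:R.
Proof. by apply: nrm_nat_sum => u _. Qed.

(** With truncated subtraction one of [r - s] and [s - r] is 0. Dropping the common part [minn r s]
    shifts the range of [u] and costs only boundary terms. *)
Lemma correlation_shift K r s :
  nrm (correlation K r s - correlation K (r - s) (s - r)) <=
  2 * G ^+ 2 * (minn r s)%:R.
Proof.
pose g u := dot (iter (u + (r - s)) T z) (iter (u + (s - r)) T z).
have -> : correlation K r s = \sum_(0 <= u < K) g (u + minn r s)%N.
  by apply: eq_bigr => u _; rewrite /g; congr (dot (iter _ T z) (iter _ T z)); clear; lia.
rewrite nrmB (nat_sum_shift g).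
apply: le_trans (nrmD _ _) _; rewrite nrmN -mulrA mulr_natl mulr2n.
by apply: lerD; apply: nrm_nat_sum => u _; exact: dotG.
Qed.

Lemma orbit_sqr_window (c : nat -> R[i]) (b : nat -> nat) K W (bm : R) :
  unit_weight c -> (forall w, (w < W)%N -> (b w)%:R <= bm) ->
  orbit_sqr T K (\sum_(0 <= w < W) c w *: iter (b w) T z) <=
  \sum_(0 <= w < W) \sum_(0 <= w' < W)
    (complex.Re (c w * Num.conj (c w') * correlation K (b w - b w') (b w' - b w))
     + 2 * G ^+ 2 * bm).
Proof.
move=> hc hb.
have -> : orbit_sqr T K (\sum_(0 <= w < W) c w *: iter (b w) T z) =
    \sum_(0 <= w < W) \sum_(0 <= w' < W)
      complex.Re (c w * Num.conj (c w') * correlation K (b w) (b w')).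
  under [RHS]eq_bigr => w _ do
    (under eq_bigr => w' _ do rewrite mulr_sumr raddf_sum/=; rewrite exchange_big/=).
  rewrite exchange_big/=; apply: eq_bigr => u _.
  rewrite linear_sum/= (nrm_sqr hdot) dot_suml raddf_sum/=; apply: eq_bigr => w _.
  rewrite dot_sumr raddf_sum/=; apply: eq_bigr => w' _.
  rewrite [iter u T (c w *: _)]linearZ [iter u T (c w' *: _)]linearZ.
  by rewrite (dotZ dot) !iterD.
apply: ler_sum_nat => w /andP[_ wW]; apply: ler_sum_nat => w' /andP[_ wW'].
rewrite -lerBlDl -raddfB/= -mulrBr; apply: le_trans (Re_le_nrm _) _.
rewrite nrmM nrmM nrm_conj.
have cc : nrm (c w) * nrm (c w') <= 1.
  by rewrite -[leRHS]mulr1; apply: ler_pM; rewrite ?nrm_ge0//; exact: hc.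
have hs : nrm (correlation K (b w) (b w') - correlation K (b w - b w') (b w' - b w))
    <= 2 * G ^+ 2 * bm.
  apply: le_trans (correlation_shift _ _ _) _; rewrite ler_wpM2l ?mulr_ge0 ?sqr_ge0//.
  by apply: le_trans (hb w wW); rewrite ler_nat geq_minl.
rewrite -[leRHS]mul1r; apply: ler_pM; rewrite ?mulr_ge0 ?nrm_ge0//.
Qed.

(** When the sum over [n] is done first, inside the scalar product, the weighted sum of [T^(r n) z]
    appears, on which the induction hypothesis bears. *)
Lemma sum_correlation (c : nat -> R[i]) (r : nat -> nat) N K :
  nrm (\sum_(0 <= n < N) c n * correlation K (r n) 0) <=
  K%:R * (M * G) * nrm (\sum_(0 <= n < N) c n *: iter (r n) T z).
Proof.
rewrite /correlation; under eq_bigr do rewrite mulr_sumr.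
rewrite exchange_big/= -mulrA mulrC; apply: nrm_nat_sum => u _.
rewrite (_ : \sum_(_ <= _ < _) _ =
    dot (iter u T (\sum_(0 <= n < N) c n *: iter (r n) T z)) (iter u T z)).
  apply: le_trans (dot_le hdot _ _) _.
  by rewrite mulrAC; apply: ler_pM; rewrite ?nrm_ge0.
rewrite linear_sum/= dot_suml; apply: eq_bigr => n _.
by rewrite linearZ/= linearZl_LR addn0 iterD.
Qed.

(** The weight is cut into the parts where [f = g] and where [f = g + 1]. Both are admissible for
    [g], and the second sum is [T] applied to one for [g]. *)
Lemma weight_null_perturb (f g : nat -> nat) n1 :
  (forall n, (n1 <= n)%N -> f n = g n \/ f n = (g n).+1) ->
  weight_null T z g -> weight_null T z f.
Proof.
move=> fg hg e e0; pose e' := e / (2 * (1 + M)).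
have M1 : 0 < 2 * (1 + M) by rewrite mulr_gt0// addr_gt0.
have e'0 : 0 < e' by rewrite divr_gt0.
have {}hg := hg _ e'0; near=> N => c hc.
pose c1 n : R[i] := ((n1 <= n)%N && (f n == g n))%:R * c n.
pose c2 n : R[i] := ((n1 <= n)%N && (f n == (g n).+1))%:R * c n.
have bool_weight (P : nat -> bool) : unit_weight (fun n => (P n)%:R * c n).
  by move=> n; case: (P n); rewrite /= ?mul1r ?mul0r ?nrm0 ?ler01//; exact: hc.
have hN c' : unit_weight c' ->
    nrm (\sum_(0 <= n < N) c' n *: iter (g n) T z) <= e' * N%:R.
  by move: c'; near: N.
have -> : \sum_(0 <= n < N) c n *: iter (f n) T z =
    \sum_(0 <= n < N) c1 n *: iter (g n) T z +
    T (\sum_(0 <= n < N) c2 n *: iter (g n) T z) +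
    \sum_(0 <= n < N) (n < n1)%:R *: (c n *: iter (f n) T z).
  rewrite linear_sum/= -!big_split/=; apply: eq_bigr => n _.
  rewrite linearZ/= /c1 /c2; case: leqP => [n1n|nn1] /=.
    rewrite scale0r addr0; case: (fg n n1n) => ->.
      rewrite eqxx ltn_eqF// !mul0r scale0r addr0 /= mul1r.
      by [].
    by rewrite eqxx gtn_eqF// mul0r scale0r add0r mul1r.
  by rewrite !mul0r !scale0r !add0r scale1r.
apply: le_trans (nrmD _ _) _.
have h3 : nrm (\sum_(0 <= n < N) (n < n1)%:R *: (c n *: iter (f n) T z)) <= e / 2 * N%:R.
  apply: (@le_trans _ _ (\sum_(0 <= n < N) (((0 <= n) && (n < 0 + n1))%N%:R * G))).
    apply: le_trans (nrm_sum _ _ _) _; apply: ler_sum => n _.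
    rewrite add0n /=; case: ltnP => _; rewrite ?scale0r ?nrm0 ?mul0r//.
    rewrite scale1r mul1r nrmZ -[leRHS]mul1r.
    by apply: ler_pM; rewrite ?nrm_ge0//; exact: hc.
  rewrite -mulr_suml -natr_sum.
  apply: (@le_trans _ _ (n1%:R * G)).
    by rewrite ler_wpM2r// ler_nat sum_interval_le.
  rewrite -ler_pdivrMl ?divr_gt0//.
  by near: N; exact: nbhs_infty_ger.
have h1 := hN c1 (bool_weight _); have h2 := hN c2 (bool_weight _).
have h4 : nrm (T (\sum_(0 <= n < N) c2 n *: iter (g n) T z)) <= M * (e' * N%:R).
  apply: le_trans (hT 1 _) _; rewrite ler_wpM2l//; exact: ltW.
have h5 := nrmD (\sum_(0 <= n < N) c1 n *: iter (g n) T z)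
  (T (\sum_(0 <= n < N) c2 n *: iter (g n) T z)).
have : e' * (2 * (1 + M)) = e by rewrite divfK// gt_eqF.
move=> /(congr1 (fun x => x * N%:R)) h6.
by lra.
Unshelve. all: by end_near. Qed.

End van_der_corput.

Section polynomial_weight_null.
Context (R : realType) (H : completeNormedModType R[i]).
Context (dot : {dot H for @Num.conj R[i]}) (hdot : induces_norm dot).
Context (T : {linear H -> H}) (M : R) (M0 : 0 < M).
Context (hT : forall n x, nrm (iter n T x) <= M * nrm x).
Context (z : H).

(* Van der Corput's inequality without a dilation: since
   [T^k(n+w) = T^(k(n)-u) T^(u+k(n+w)-k(n))] for [u <= k(n)], the window sums are
   controlled by averages over [u < k(N/L)] of a correlation that is almost
   invariant under shifts of size [k(n+W) - k(n) = o(k(N/L))]. *)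
Lemma weight_null_step (p : {poly R}) d : size p = d.+3 -> 0 < lead_coef p ->
  (forall q : {poly R}, size q = d.+2 -> 0 < lead_coef q ->
    weight_null T z (fun n => Num.truncn q.[n%:R])) ->
  weight_null T z (fun n => Num.truncn p.[n%:R]).
Proof.
have sub3 (x y m : nat) : (m <= x)%N -> (m <= y)%N -> (x - m - (y - m) = x - y)%N.
  by clear; lia.
move=> sp lp ih; pose k n := Num.truncn p.[n%:R].
pose G := M * nrm z + 1.
have G0 : 0 < G by rewrite ltr_wpDl// mulr_ge0 ?nrm_ge0// ltW.
have hG u : nrm (iter u T z) <= G by rewrite (le_trans (hT _ _))// lerDl.
have [n1 mono] := poly_eventually_mono sp lp.
have kmono n w : (n1 <= n)%N -> (k n <= k (n + w))%N.
  by move=> n1n; have /andP[_ h] := mono n w n1n; apply: le_truncn.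
(* The induction hypothesis for the difference polynomial, corrected by the error 0 or 1 of a
   difference of integer parts. *)
have gap w w' : (w' < w)%N -> weight_null T z (fun n => k (n + w) - k (n + w'))%N.
  move=> w'w; have [sq lq] := diff_shift_poly sp w'w.
  apply: (@weight_null_perturb _ _ T M M0 hT z G hG _ _ n1) (ih _ sq _); last first.
    by rewrite lq mulr_gt0// ltr0n muln_gt0 subn_gt0.
  move=> n n1n; rewrite hornerD hornerN !horner_shift_poly.
  apply: truncn_subr.
  have := mono (n + w')%N (w - w')%N (leq_trans n1n (leq_addr _ _)).
  by rewrite -addnA subnKC// ltnW.
apply: (mnull_window (B := G)) => [c n hc|e e0].
  by rewrite (le_trans (nrm_weighted hT _ _ _ hc))// lerDl.
(* [W] makes the contribution of the diagonal pairs small, and [L] that of the initial stretch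
   [n < N %/ L], which is estimated trivially. Each takes half of [e]. *)
pose W := (Num.truncn (4 * M ^+ 2 * G ^+ 2 / e)).+1.
have W0 : 0 < W%:R :> R by rewrite ltr0n.
have hW : 4 * M ^+ 2 * G ^+ 2 <= e * W%:R.
  by rewrite [leRHS]mulrC -ler_pdivrMr//; exact/ltW/truncnS_gt.
pose L := (Num.truncn (2 * G ^+ 2 / e)).+1.
have L0 : 0 < L%:R :> R by rewrite ltr0n.
have hL : 2 * G ^+ 2 <= e * L%:R.
  by rewrite [leRHS]mulrC -ler_pdivrMr//; exact/ltW/truncnS_gt.
exists W => //.
(* [be] bounds the relative shift of a correlation and [de] the sums of the induction hypothesis;
   each uses half of the share [1 / W] that [sum_diagonal] grants to a pair. *)
pose be : R := (4 * W%:R)^-1.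
have be0 : 0 < be by rewrite invr_gt0 mulr_gt0.
pose de : R := G / (2 * M * W%:R).
have de0 : 0 < de by rewrite divr_gt0// !mulr_gt0.
have near_gap : \forall N \near \oo, forall w, (w < W)%N -> forall w', (w' < W)%N ->
    (w' < w)%N -> forall c : nat -> R[i], unit_weight c ->
    nrm (\sum_(0 <= n < N) c n *: iter (k (n + w) - k (n + w')) T z) <= de * N%:R.
  apply: near_forall_lt => w wW; apply: near_forall_lt => w' w'W.
  have [w'w|_] := ltnP w' w; last by exists 0%N.
  by have := gap _ _ w'w _ de0; apply: filterS => N hN _.
have near_K : \forall N \near \oo, 2 <= p.[(N %/ L)%N%:R].
  have s2 : (size (2%:R%:P : {poly R}) <= d.+2)%N.
    by rewrite (leq_trans (size_polyC_leq1 _)).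
  have := poly_small s2 sp lp ltr01 (ltn0Sn _ : (0 < L)%N); apply: filterS => N /(_ 0%N isT).
  by rewrite hornerC mul1r ger0_norm.
have near_b : \forall N \near \oo, forall n, (n <= N)%N -> (n1 <= n)%N ->
    (k (n + W) - k n)%:R <= be / 2 * p.[(N %/ L)%N%:R].
  have [sq lq] := diff_shift_poly sp (ltn0Sn _ : (0 < W)%N).
  (* The added constant 1 covers the rounding in a difference of two integer parts. *)
  have sq1 : (size (shift_poly p W - shift_poly p 0 + 1%:P)%R <= d.+2)%N.
    by rewrite (leq_trans (size_polyD _ _))// geq_max sq leqnn (leq_trans (size_polyC_leq1 _)).
  have be2 : 0 < be / 2 by rewrite divr_gt0.
  have := poly_small sq1 sp lp be2 (ltn0Sn _ : (0 < L)%N).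
  apply: filterS => N hN n nN n1n; apply: le_trans (hN n nN).
  rewrite 2!hornerD hornerN hornerC !horner_shift_poly addn0.
  have := mono n W n1n => /andP[p0 pp].
  rewrite ger0_norm; last by lra.
  have /andP[h1 _] := truncn_itv (le_trans p0 pp).
  have /andP[_ h2] := truncn_itv p0.
  rewrite natrB ?kmono// /k; rewrite -natr1 in h2.
  by lra.
near=> N => c hc.
pose n0 := (N %/ L)%N; pose K := k n0.
have n1n0 : (n1 <= n0)%N.
  rewrite /n0 leq_divRL//; near: N; exact: nbhs_infty_ge.
have p2 : 2 <= p.[n0%:R] by rewrite /n0; near: N; exact: near_K.
have pK : p.[n0%:R] <= 2 * K%:R.
  have /andP[_] := truncn_itv (le_trans (ler0n R 2) p2 : 0 <= p.[n0%:R]).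
  by rewrite -natr1 -/K; lra.
have K0 : 0 < K%:R :> R by lra.
pose D n := nrm (\sum_(0 <= w < W) c (n + w)%N *: iter (k (n + w)%N) T z).
have Dle n : D n <= G * W%:R.
  apply: nrm_nat_sum => w _; rewrite nrmZ -[leRHS]mul1r.
  by apply: ler_pM; rewrite ?nrm_ge0//; exact: hc.
have D0 n : 0 <= D n by exact: nrm_ge0.
have KleN n : (n0 <= n)%N -> (K <= k n)%N.
  by move=> n0n; rewrite -(subnKC n0n); exact: kmono.
(* The cut-off [n0 <= n], which guarantees [K <= k n], is put into the weight, so that sums still
   run over all [n < N]. *)
pose a w w' n : R[i] := (n0 <= n)%N%:R * (c (n + w)%N * Num.conj (c (n + w')%N)).
have a1 w w' : unit_weight (a w w').
  move=> n; rewrite /a !nrmM nrm_conj; case: (n0 <= n)%N; rewrite /= ?nrm0 ?mul0r ?ler01//.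
  by rewrite nrm1 mul1r -[leRHS]mul1r; apply: ler_pM; rewrite ?nrm_ge0//; exact: hc.
pose F n w w' := a w w' n *
   correlation dot T z K (k (n + w) - k (n + w'))%N (k (n + w') - k (n + w))%N.
have D_window n : (n < N)%N -> K%:R * ((n0 <= n)%N%:R * D n ^+ 2) <=
    M ^+ 2 * \sum_(0 <= w < W) \sum_(0 <= w' < W)
      (complex.Re (F n w w') + 2 * G ^+ 2 * (be * K%:R)).
  move=> nN; rewrite /F /a; case: (leqP n0 n) => [n0n|_] /=; last first.
    rewrite mul0r mulr0 mulr_ge0 ?sqr_ge0//.
    apply: sumr_ge0 => w _; apply: sumr_ge0 => w' _.
    by rewrite !mul0r raddf0 add0r !mulr_ge0 ?sqr_ge0// ltW.
  have n1n := leq_trans n1n0 n0n.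
  rewrite mul1r; pose y := \sum_(0 <= w < W) c (n + w)%N *: iter (k (n + w) - k n)%N T z.
  have -> : D n = nrm (iter (k n) T y).
    rewrite /D /y linear_sum/=; congr nrm; apply: eq_bigr => w _.
    by rewrite linearZ/= -iterD subnKC ?kmono.
  apply: le_trans (orbit_sqr_pull M0 hT y (KleN n n0n)) _.
  rewrite ler_wpM2l ?sqr_ge0//.
  have bW w : (w < W)%N -> (k (n + w) - k n)%N%:R <= be * K%:R.
    move=> wW; apply: (@le_trans _ _ (k (n + W) - k n)%N%:R).
      rewrite ler_nat leq_sub2r//.
      have := kmono (n + w)%N (W - w)%N (leq_trans n1n (leq_addr _ _)).
      by rewrite -addnA subnKC// ltnW.
    have : (k (n + W) - k n)%N%:R <= be / 2 * p.[n0%:R].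
      have hb : forall m, (m <= N)%N -> (n1 <= m)%N ->
          (k (m + W) - k m)%N%:R <= be / 2 * p.[(N %/ L)%N%:R].
        by near: N; exact: near_b.
      exact: hb (ltnW nN) n1n.
    move/le_trans; apply; rewrite -mulrA ler_wpM2l ?(ltW be0)//.
    by rewrite mulrC ler_pdivrMr// mulrC.
  have := @orbit_sqr_window _ _ _ hdot T z G hG (fun w => c (n + w)%N)
    (fun w => k (n + w) - k n)%N K W _ (fun w => hc _) bW.
  move/le_trans; apply; apply: ler_sum_nat => w _; apply: ler_sum_nat => w' _.
  have := kmono n w n1n; have := kmono n w' n1n => h1 h2.
  by rewrite !mul1r (sub3 _ _ _ h2 h1) (sub3 _ _ _ h1 h2).
have pair w w' : (w < W)%N -> (w' < W)%N ->
    \sum_(0 <= n < N) (complex.Re (F n w w') + 2 * G ^+ 2 * (be * K%:R)) <=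
    (w == w')%:R * (K%:R * G ^+ 2 * N%:R) + W%:R^-1 * (K%:R * G ^+ 2 * N%:R).
  have off v v' : (v' < v)%N -> (v < W)%N -> (v' < W)%N ->
      nrm (\sum_(0 <= n < N) F n v v') <= W%:R^-1 / 2 * (K%:R * G ^+ 2 * N%:R).
    move=> v'v vW v'W.
    have -> : \sum_(0 <= n < N) F n v v' = \sum_(0 <= n < N) a v v' n *
        correlation dot T z K (k (n + v) - k (n + v'))%N 0.
      apply: eq_bigr => n _; rewrite /F /a; case: leqP => [n0n|_]; last by rewrite !mul0r.
      have := kmono (n + v')%N (v - v')%N (leq_trans (leq_trans n1n0 n0n) (leq_addr _ _)).
      by rewrite -addnA subnKC ?(ltnW v'v)// -subn_eq0 => /eqP ->.
    apply: le_trans (sum_correlation hdot hT hG _ _ _ _) _.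
    have : nrm (\sum_(0 <= n < N) a v v' n *: iter (k (n + v) - k (n + v')) T z) <= de * N%:R.
      move: (a v v') (a1 v v') v'v v'W; move: v' v vW => v' v vW b hb v'v v'W.
      by move: v vW v' v'W v'v b hb; near: N.
    have KMG : 0 <= K%:R * (M * G) by rewrite !mulr_ge0// ltW.
    move=> /(ler_wpM2l KMG)/le_trans; apply.
    rewrite le_eqVlt; apply/orP; left; apply/eqP; rewrite /de; field.
    by rewrite !gt_eqF.
  move=> wW w'W; rewrite big_split/= sumr_const_nat subn0 -[_ *+ N]mulr_natr.
  rewrite -raddf_sum/=.
  have hbe : 2 * G ^+ 2 * (be * K%:R) * N%:R = W%:R^-1 / 2 * (K%:R * G ^+ 2 * N%:R).
    by rewrite /be; field; rewrite gt_eqF.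
  rewrite hbe.
  set x := K%:R * G ^+ 2 * N%:R; have x0 : 0 <= x by rewrite !mulr_ge0 ?sqr_ge0// ltW.
  have Wx : 0 <= W%:R^-1 * x by rewrite mulr_ge0// invr_ge0 ltW.
  have -> : W%:R^-1 * x = W%:R^-1 / 2 * x + W%:R^-1 / 2 * x by field; rewrite gt_eqF.
  rewrite addrA lerD2r; apply: le_trans (_ : nrm (\sum_(0 <= n < N) F n w w') <= _).
    exact: Re_le_nrm.
  case: (ltngtP w w') => [ww'|w'w|<-].
  - rewrite mul0r add0r -nrm_conj rmorph_sum/=.
    rewrite (eq_bigr (fun n => F n w' w)); first exact: off.
    move=> n _; rewrite /F /a !rmorphM/= correlation_conj conjCK rmorph_nat.
    by rewrite [c (n + w')%N * _]mulrC.
  - by rewrite mul0r add0r; exact: off.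
  - rewrite mul1r; apply: le_trans (_ : x <= _); last by rewrite lerDl; lra.
    rewrite /x; apply: nrm_nat_sum => n _; rewrite /F nrmM -[leRHS]mul1r.
    apply: ler_pM; rewrite ?nrm_ge0//; first exact: a1.
    by rewrite mulrC; exact: nrm_correlation.
have tail : \sum_(0 <= n < N) (n0 <= n)%N%:R * D n ^+ 2 <= 2 * M ^+ 2 * W%:R * G ^+ 2 * N%:R.
  rewrite -(ler_pM2l K0) mulr_sumr.
  apply: le_trans (ler_sum_nat (fun n h => D_window n (proj2 (andP h)))) _.
  rewrite -mulr_sumr exchange_big/=.
  have -> : K%:R * (2 * M ^+ 2 * W%:R * G ^+ 2 * N%:R) =
    M ^+ 2 * (2 * (W%:R * (K%:R * G ^+ 2 * N%:R))) by ring.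
  rewrite ler_wpM2l ?sqr_ge0// -sum_diagonal//.
  apply: ler_sum_nat => w /andP[_ wW]; rewrite exchange_big/=.
  by apply: ler_sum_nat => w' /andP[_ w'W]; exact: pair.
have head : \sum_(0 <= n < N) (n < n0)%N%:R * D n ^+ 2 <= n0%:R * (G * W%:R) ^+ 2.
  apply: (@le_trans _ _ (\sum_(0 <= n < N) ((0 <= n) && (n < 0 + n0))%N%:R * (G * W%:R) ^+ 2)).
    apply: ler_sum => n _; rewrite add0n /= ler_wpM2l//.
    by rewrite lerXn2r ?nnegrE ?mulr_ge0// ltW.
  by rewrite -mulr_suml -natr_sum ler_wpM2r ?sqr_ge0// ler_nat sum_interval_le.
have -> : \sum_(0 <= n < N) nrm (\sum_(0 <= w < W)
      c (n + w)%N *: iter (Num.truncn p.[(n + w)%N%:R]) T z) ^+ 2 =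
    \sum_(0 <= n < N) (n < n0)%N%:R * D n ^+ 2 + \sum_(0 <= n < N) (n0 <= n)%N%:R * D n ^+ 2.
  rewrite -big_split/=; apply: eq_bigr => n _; rewrite -mulrDl ltnNge -/(D n).
  by case: (n0 <= n)%N; rewrite /= ?add0r ?addr0 mul1r.
have n0L : n0%:R * L%:R <= N%:R :> R by rewrite -natrM ler_nat leq_divM.
have N0 : 0 <= N%:R :> R by [].
have h1 : 2 * (n0%:R * (G * W%:R) ^+ 2) <= e * W%:R ^+ 2 * N%:R.
  have := ler_wpM2l (ler0n R n0) hL.
  have n00 : 0 <= n0%:R :> R by [].
  move=> /(ler_wpM2r (sqr_ge0 (W%:R : R))) h.
  have := ler_wpM2r (sqr_ge0 (W%:R : R)) (ler_wpM2l (ltW e0) n0L).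
  by lra.
have h2 : 2 * (2 * M ^+ 2 * W%:R * G ^+ 2 * N%:R) <= e * W%:R ^+ 2 * N%:R.
  have := ler_wpM2r N0 (ler_wpM2r (ltW W0) hW).
  by lra.
by lra.
Unshelve. all: by end_near. Qed.

Lemma weight_null_poly d (p : {poly R}) : size p = d.+2 -> 0 < lead_coef p ->
  weight_null T z id -> weight_null T z (fun n => Num.truncn p.[n%:R]).
Proof.
move=> sp lp hid; elim: d p sp lp => [|d ih] p sp lp.
  exact: weight_null_linear.
exact: weight_null_step sp lp ih.
Qed.

End polynomial_weight_null.

(** * Convergence of the averages *)

Lemma mcauchy_eventually (R : realType) (V : normedZmodType R[i])
    (a b : nat -> V) n1 :
  (forall n, (n1 <= n)%N -> a n = b n) -> mcauchy b -> mcauchy a.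
Proof.
move=> ab hb; apply: mcauchy_approx => e e0; exists b => //; near=> N.
have n1N : (n1 <= N)%N by near: N; exact: nbhs_infty_ge.
rewrite -(subnKC n1N) nat_sumD [X in _ + X]big1 ?addr0; last first.
  by move=> n _; rewrite ab ?leq_addr// subrr.
rewrite subnKC// -ler_pdivrMl//; near: N; exact: nbhs_infty_ger.
Unshelve. all: by end_near. Qed.

Lemma power_bounded_le (R : realType) (H : normedModType R[i])
    (T : {linear H -> H}) : power_bounded T ->
  exists2 M : R, 0 < M & forall n x, nrm (iter n T x) <= M * nrm x.
Proof.
rewrite /power_bounded; set s := ereal_sup _ => s_lt.
have hs n x : nrm x <= 1 -> ((nrm (iter n T x))%:E <= s)%E.
  move=> x1; apply: (@le_trans _ _ (opnorm (iter n T))).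
    apply: ereal_sup_ubound; exists x => //=.
    by rewrite nrmE -(rmorph1 (real_complex R)) lecR.
  by apply: ereal_sup_ubound; exists n.
have [r sr] : exists r, s = r%:E.
  case: (s) s_lt hs => [r| |] // _ hs; first by exists r.
  by have := hs 0%N 0; rewrite nrm0 => /(_ ler01).
have {}hs n x : nrm x <= 1 -> nrm (iter n T x) <= r.
  by move=> /(hs n); rewrite sr lee_fin.
have r0 : 0 <= r by apply: le_trans (nrm_ge0 _) (hs 0%N 0 _); rewrite nrm0.
exists (r + 1) => [|n x]; first by rewrite ltr_wpDl.
have [->|x0] := eqVneq x 0; first by rewrite linear0 !nrm0 mulr0.
have n0 : 0 < nrm x by rewrite lt_def nrm_eq0 x0 nrm_ge0.
have nV : nrm ((nrm x)^-1%:C%C : R[i]) = (nrm x)^-1.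
  by rewrite nrm_real ger0_norm// invr_ge0 ltW.
have := hs n ((nrm x)^-1%:C%C *: x); rewrite linearZ/= !nrmZ nV.
rewrite mulVf ?gt_eqF// => /(_ (lexx _)); rewrite ler_pdivrMl// mulrC => h.
by rewrite (le_trans h)// ler_wpM2r ?lerDl// ltW.
Qed.

Lemma zpower_floor (R : archiRealFieldType) (H : Type) (T : H -> H) (x : R) :
  0 <= x -> zpower T (Num.floor x) = iter (Num.truncn x) T.
Proof. by rewrite truncEfloor -floor_ge0; case: (Num.floor x). Qed.

Lemma zpower_neg (R : archiRealFieldType) (H : Type) (T : H -> H) (x : R) :
  x < 0 -> zpower T (Num.floor x) = id.
Proof. by rewrite ltNge -floor_ge0; case: (Num.floor x). Qed.

Lemma natr_truncn (R : archiRealFieldType) (x : R) :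
  0 <= x -> (Num.truncn x)%:R = (Num.floor x)%:~R :> R.
Proof. by rewrite truncEfloor -floor_ge0; case: (Num.floor x). Qed.

Section orbit_averages.
Context (R : realType) (H : completeNormedModType R[i]).
Context (dot : {dot H for @Num.conj R[i]}) (hdot : induces_norm dot).
Context (T : {linear H -> H}) (M : R) (M0 : 0 < M).
Context (hT : forall n x, nrm (iter n T x) <= M * nrm x).

(** On an eigenvector [T^k] is the scalar [e(k t)], which reduces to [mcauchy_bracket]; [truncn] and
    [floor] agree once [p(n) >= 0]. *)
Lemma mcauchy_eigspan (p q : {poly R}) d y : size p = d.+2 -> 0 < lead_coef p ->
  eigspan T y ->
  mcauchy (fun n => expi2pi q.[n%:R] *: iter (Num.truncn p.[n%:R]) T y).
Proof.
move=> sp lp; elim=> [|t v w tv _ ih].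
  apply: eq_mcauchy (@mcauchy0 _ _) => n.
  by rewrite linear0 scaler0.
have [n1 mono] := poly_eventually_mono sp lp.
have hv : mcauchy (fun n => expi2pi q.[n%:R] *: iter (Num.truncn p.[n%:R]) T v).
  apply: mcauchy_eventually (mcauchy_scale v (mcauchy_bracket t p q)) => n n1n.
  have /andP[p0 _] := mono n 0%N n1n.
  by rewrite (iter_eigenvector _ tv) scalerA -e2piD natr_truncn// [t * _]mulrC.
apply: eq_mcauchy (mcauchyD hv ih) => n.
by rewrite -scalerDr -linearD.
Qed.

Lemma mcauchy_orbit (p q : {poly R}) x :
  mcauchy (fun n => expi2pi q.[n%:R] *: zpower T (Num.floor p.[n%:R]) x).
Proof.
have [sp|] := leqP (size p) 1.
  apply: eq_mcauchy (mcauchy_scale (zpower T (Num.floor p`_0) x) (mcauchy_weyl q)) => n.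
  by rewrite (size1_horner _ sp).
case sp : (size p) => [|[|d]]// _.
have [lp|lp|lp0] := ltgtP (lead_coef p) 0; last first.
- by move: lp0 => /eqP; rewrite lead_coef_eq0 -size_poly_eq0 sp.
- have [n1 mono] := poly_eventually_mono sp lp.
  apply: (mcauchy_eventually (n1 := n1)
    (b := fun n => expi2pi q.[n%:R] *: iter (Num.truncn p.[n%:R]) T x)) => [n n1n|].
    have /andP[p0 _] := mono n 0%N n1n.
    by rewrite zpower_floor.
  have [y [z [-> hy hz]]] := decomposition hdot hT x.
  apply: mcauchy_approx => e e0.
  have e2 : 0 < e / 2 by rewrite divr_gt0.
  have [y' hy' yy'] := hy (e / 2 / M) ltac:(by rewrite !divr_gt0).
  exists (fun n => expi2pi q.[n%:R] *: iter (Num.truncn p.[n%:R]) T y').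
    exact: mcauchy_eigspan sp lp hy'.
  have hz' := weight_null_poly hdot M0 hT sp lp (weight_null_id hdot M0 hT hz) e2.
  near=> N.
  have uw : unit_weight (fun n => expi2pi q.[n%:R]) by move=> n; rewrite nrm_e2pi.
  have hN : nrm (\sum_(0 <= n < N) expi2pi q.[n%:R] *: iter (Num.truncn p.[n%:R]) T z)
      <= e / 2 * N%:R.
    have hc (c : nat -> R[i]) : unit_weight c ->
        nrm (\sum_(0 <= n < N) c n *: iter (Num.truncn p.[n%:R]) T z) <= e / 2 * N%:R.
      by move: c; near: N; exact: hz'.
    exact: hc uw.
  have -> : \sum_(0 <= n < N) (expi2pi q.[n%:R] *: iter (Num.truncn p.[n%:R]) T (y + z) -
      expi2pi q.[n%:R] *: iter (Num.truncn p.[n%:R]) T y') =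
    \sum_(0 <= n < N) expi2pi q.[n%:R] *: iter (Num.truncn p.[n%:R]) T (y - y') +
    \sum_(0 <= n < N) expi2pi q.[n%:R] *: iter (Num.truncn p.[n%:R]) T z.
    rewrite -big_split/=; apply: eq_bigr => n _.
    by rewrite -scalerBr -scalerDr -linearB -linearD addrAC.
  apply: le_trans (nrmD _ _) _; rewrite [e in leRHS](splitr e) mulrDl.
  apply: lerD hN; apply: nrm_nat_sum => n _; rewrite nrmZ nrm_e2pi mul1r.
  by apply: le_trans (hT _ _) _; rewrite mulrC -ler_pdivlMr.
(* Here the exponents are eventually negative, so the convention leaves a scalar Weyl sum times
   [x]. *)
- have lp' : 0 < lead_coef (- p) by rewrite lead_coefN oppr_gt0.
  have sp' : size (- p) = d.+2 by rewrite size_polyN.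
  have [n1 _ hn1] := poly_lower sp' lp'.
  apply: (mcauchy_eventually (n1 := n1.+1)) (mcauchy_scale x (mcauchy_weyl q)) => n n1n.
  have := hn1 n (ltnW n1n); rewrite hornerN => hn.
  have p0 : p.[n%:R] < 0.
    rewrite -oppr_gt0; apply: lt_le_trans hn; rewrite mulr_gt0 ?divr_gt0// exprn_gt0//.
    by rewrite ltr0n (leq_ltn_trans _ n1n).
  by rewrite zpower_neg.
Unshelve. all: by end_near. Qed.

Lemma mcauchy_converges (a : nat -> H) : mcauchy a ->
  exists l, forall e : R, 0 < e ->
    \forall N \near \oo, nrm (N%:R^-1 *: (\sum_(0 <= n < N) a n) - l) <= e.
Proof.
move=> ha; apply: nrm_complete => e e0; have e2 : 0 < e / 2 by rewrite divr_gt0.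
have [l [n0 _ hl]] := ha _ e2.
have {}hl m : (n0.+1 <= m)%N -> nrm (m%:R^-1 *: (\sum_(0 <= n < m) a n) - l) <= e / 2.
  move=> n0m; have m0 : 0 < m%:R :> R by rewrite ltr0n (leq_ltn_trans _ n0m).
  have -> : m%:R^-1 *: (\sum_(0 <= n < m) a n) - l =
      m%:R^-1 *: (\sum_(0 <= n < m) a n - l *+ m).
    rewrite scalerBr -[l *+ m](scaler_nat m l) scalerA mulVf ?scale1r//.
    by rewrite pnatr_eq0 -lt0n -(ltr0n R).
  by rewrite nrmZ nrm_natV ler_pdivrMl// mulrC; apply: hl; exact: ltnW.
exists n0.+1 => m n0m; rewrite -[X in X - _](subrK l) -addrA.
apply: le_trans (nrmD _ _) _; rewrite [leRHS]splitr; apply: lerD; first exact: hl.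
by rewrite nrmB; exact: hl.
Qed.

End orbit_averages.

Lemma eq_of_nrm_le (R : realType) (V : normedZmodType R[i]) (x y : V) :
  (forall e : R, 0 < e -> nrm (x - y) <= e) -> x = y.
Proof.
move=> h; apply/eqP; rewrite -subr_eq0 -nrm_eq0 eq_le nrm_ge0 andbT.
by apply/ler_addgt0Pr => e e0; rewrite add0r; exact: h.
Qed.

Theorem corollary4p16 (R : realType) (H : completeNormedModType R[i])
    (dot : {dot H for @Num.conj R[i]}) (hdot : induces_norm dot)
    (T : {linear H -> H}) (hT : bounded_operator T) (hpb : power_bounded T)
    (p q : {poly R}) :
  sot_converges (weighted_average T p q).
Proof.
have [M M0 hM] := power_bounded_le hpb.
have zpower_linear k : linear (zpower T k).
  by case: k => n a x y //=; exact: linearP.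
(* The maximum with 1 accounts for the identity at negative exponents. *)
have zpower_le k x : nrm (zpower T k x) <= Num.max 1 M * nrm x.
  case: k => n /=; last by rewrite ler_peMl ?nrm_ge0// le_max lexx.
  by rewrite (le_trans (hM _ _))// ler_wpM2r ?nrm_ge0// le_max lexx orbT.
(* The averages start at [n = 1], the sums above at 0: both polynomials are shifted by 1. *)
have avgE N x : weighted_average T p q N x = N%:R^-1 *: \sum_(0 <= n < N)
    expi2pi (shift_poly q 1).[n%:R] *:
    zpower T (Num.floor (shift_poly p 1).[n%:R]) x.
  rewrite /weighted_average big_add1 /=; congr (_ *: _); apply: eq_bigr => n _.
  by rewrite !horner_shift_poly addn1.
have /choice[f hf] : forall x, exists l, forall e : R, 0 < e ->
    \forall N \near \oo, nrm (weighted_average T p q N x - l) <= e.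
  move=> x; have [l hl] := mcauchy_converges
    (mcauchy_orbit hdot M0 hM (shift_poly p 1) (shift_poly q 1) x).
  by exists l => e /hl; apply: filterS => N; rewrite avgE.
have avg_linear N : linear (weighted_average T p q N).
  move=> a x y; rewrite /weighted_average.
  under eq_bigr do rewrite (zpower_linear _ a x y) scalerDr scalerA mulrC -scalerA.
  by rewrite big_split/= -scaler_sumr scalerDr !scalerA mulrC.
have avg_le N x : nrm (weighted_average T p q N x) <= Num.max 1 M * nrm x.
  rewrite avgE; have [->|N0] := posnP N.
    by rewrite big_geq// scaler0 nrm0 mulr_ge0 ?nrm_ge0// le_max ler01.
  rewrite nrmZ nrm_natV ler_pdivrMl ?ltr0n// mulrC.
  by apply: nrm_nat_sum => n _; rewrite nrmZ nrm_e2pi mul1r.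
(* The limit was chosen separately for each vector; linearity comes from one [N] that serves three
   vectors at once. *)
have f_linear : linear f.
  move=> a x y; apply: eq_of_nrm_le => e e0.
  have a0 : 0 < nrm a + 2 by rewrite ltr_wpDl ?nrm_ge0.
  have e' : 0 < e / (nrm a + 2) by rewrite divr_gt0.
  have h1 := hf (a *: x + y) _ e'; have h2 := hf x _ e'; have h3 := hf y _ e'.
  have [N [g1 g2 g3]] : exists N, [/\
    nrm (weighted_average T p q N (a *: x + y) - f (a *: x + y)) <= e / (nrm a + 2),
    nrm (weighted_average T p q N x - f x) <= e / (nrm a + 2) &
    nrm (weighted_average T p q N y - f y) <= e / (nrm a + 2)].
    near \oo => N; exists N; split; near: N; assumption.
  have -> : f (a *: x + y) - (a *: f x + f y) =
     - (weighted_average T p q N (a *: x + y) - f (a *: x + y)) +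
     (a *: (weighted_average T p q N x - f x) + (weighted_average T p q N y - f y)).
    rewrite (avg_linear N a x y) opprB scalerBr.
    set A := a *: weighted_average _ _ _ _ _; set B := weighted_average _ _ _ _ _.
    by rewrite [X in _ = _ + X]addrACA -opprD addrA subrK.
  apply: le_trans (nrmD _ _) _; rewrite nrmN.
  have := nrmD (a *: (weighted_average T p q N x - f x)) (weighted_average T p q N y - f y).
  rewrite nrmZ; have := ler_wpM2l (nrm_ge0 a) g2.
  have : e / (nrm a + 2) * (nrm a + 2) = e by rewrite divfK// gt_eqF.
  by lra.
pose S : {linear H -> H} := HB.pack f (GRing.isLinear.Build R[i] H H _ f f_linear).
have f_le x : nrm (f x) <= Num.max 1 M * nrm x.
  apply/ler_addgt0Pr => e e0; have h := hf x _ e0.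
  near \oo => N; have hN : nrm (weighted_average T p q N x - f x) <= e by near: N.
  have := nrmD (weighted_average T p q N x) (f x - weighted_average T p q N x).
  rewrite addrC subrK nrmB => /le_trans; apply.
  by rewrite lerD.
exists S; split => [|x].
  apply: (@le_lt_trans _ _ (Num.max 1 M)%:E); last exact: ltry.
  apply: ge_ereal_sup => _ [x /= x1 <-]; rewrite lee_fin.
  apply: le_trans (f_le x) _; rewrite ler_piMr ?le_max ?ler01//.
  by move: x1; rewrite nrmE -(rmorph1 (real_complex R)) lecR.
apply/cvgrPdist_le => e e0.
have eE : e = (complex.Re e)%:C%C by rewrite RRe_real ?gtr0_real.
have e0' : 0 < complex.Re e by move: e0; rewrite ltcE => /andP[].
have := hf x _ e0'; apply: filterS => N.
by rewrite nrmE nrmB [in X in _ -> X]eE lecR.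
Unshelve. all: by end_near. Qed.
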